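(* Let $k=\sum_{n\ge0}\kappa_n\otimes e_n^*$, an $(\ell^2)^*$-valued kernel on the Cantor group $G$. The operator $f\mapsto\mathrm{P.V.}(k*f)$ coincides, for $f\in L^2(G,\ell^2)$, with the map $\iota^{-1}P:L^2(G,\ell^2)\to H^2(\delta)$, i.e. $f=(f_n)\mapsto\sum_n\Delta_nf_n$, and for $f\in L^1(G,\ell^2)$ the principal value exists almost everywhere and defines a bounded operator $L^1(G,\ell^2)\to L^{1,\infty}(G)$ (hence a bounded operator $L^p(G,\ell^2)\to L^p(G)$ for $1<p<\infty$).
   Context: $G=\mathbb{Z}_2^{\mathbb{N}^+}$ with Haar probability measure $\mu$, coordinatewise addition mod 2, identity $\emptyset$, metric $d(x,y)=2^{-\min\{k:x_k\ne y_k\}}$, and $\min x=\min\{k:x_k=1\}$. $\mathcal{F}_n$ is generated by $x_1,\dots,x_n$, $\mathbb{E}_n$ its conditional expectation, $\Delta_0=\mathbb{E}_0$, $\Delta_n=\mathbb{E}_n-\mathbb{E}_{n-1}$. For finite $A\subset\mathbb{N}^+$, $w_A(x)=(-1)^{\sum_{k\in A}x_k}$, $\max\emptyset=0$; $\kappa_n=\sum_{\max A=n}w_A$, i.e. $\kappa_0\equiv1$ and for $n\ge1$, $\kappa_n(x)=2^{n-1}$ if $n<\min x$, $-2^{n-1}$ if $n=\min x$, $0$ if $n>\min x$; thus $\kappa_n*g=\Delta_ng$. $e_n^*$ is the $n$-th coordinate functional on $\ell^2$. $(k*f)(x)=\int_Gk(y)f(x-y)\,d\mu(y)$ and $\mathrm{P.V.}(k*f)(x)=\lim_{r\to0}\int_{G\setminus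 B(\emptyset,r)}k(y)f(x-y)\,d\mu(y)$. $P$ is the orthogonal projection of $L^2(G,\ell^2)$ onto $\{(f_n):\Delta_nf_n=f_n\ \forall n\}$, $\iota(g)=(\Delta_ng)_n$, and $H^2(\delta)=L^2(G)$ with norm $(\mathbb{E}\sum_n|\Delta_ng|^2)^{1/2}$. $L^{1,\infty}(G)$ is weak $L^1$ with quasinorm $\sup_\lambda\lambda\mu\{|g|>\lambda\}$. *)

(* Defs.v *)
From HB Require Import structures.
From mathcomp Require Import all_boot all_order all_algebra.
From mathcomp Require Import all_classical all_reals all_analysis.
Set Implicit Arguments. Unset Strict Implicit. Unset Printing Implicit Defensive.
Import Order.TTheory GRing.Theory Num.Theory.
Import numFieldNormedType.Exports.
Local Open Scope classical_set_scope.
Local Open Scope ring_scope.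

(* Carrier of the Cantor group Z_2^{N^+}: coordinate k >= 1 of the paper is
   stored at index k-1, i.e. x_k = x (k-1). *)
Definition Gc := nat -> bool.

Definition cyl (n : nat) (a : Gc) : set Gc := [set y | forall i, (i < n)%N -> y i = a i].
Definition cylinders : set (set Gc) := [set A | exists n a, A = cyl n a].

Definition G := g_sigma_algebraType cylinders.

(* group law (coordinatewise addition mod 2 = subtraction), identity *)
Definition gsub (x y : Gc) : Gc := fun i => xorb (x i) (y i).
Definition zeroG : Gc := fun _ => false.

(* d(x,y) = 2^{-min{k : x_k <> y_k}} (coordinates 1-based), d(x,x) = 0 *)
Definition dist {R : realType} (x y : Gc) : R :=
  match pselect (exists k, x k != y k) with
  | left h => (2^-1) ^+ (ex_minn h).+1
  | right _ => 0
  end.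

(* Haar probability measure: mass 2^{-n} on every cylinder of length n
   (this determines the measure on the generated sigma-algebra). *)
Definition haar {R : realType} (mu : {measure set G -> \bar R}) : Prop :=
  forall n (a : Gc), mu (cyl n a) = ((2^-1 : R) ^+ n)%:E.

(* kappa_0 = 1; kappa_n(x) = 2^{n-1} if n < min x, -2^{n-1} if n = min x,
   0 if n > min x (n >= 1). *)
Definition kappa {R : realType} (n : nat) (x : Gc) : R :=
  match n with
  | 0 => 1
  | m.+1 =>
    if `[< forall i, (i <= m)%N -> x i = false >] then 2 ^+ m
    else if `[< (forall i, (i < m)%N -> x i = false) /\ x m = true >] then - 2 ^+ m
    else 0
  end.

(* conditional expectation E_n h (x) = 2^n * integral of h over the atom of F_n
   containing x; Delta_0 = E_0, Delta_n = E_n - E_{n-1}. *)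
Definition condE {R : realType} (mu : {measure set G -> \bar R}) (n : nat)
  (h : G -> R) (x : G) : R :=
  2 ^+ n * Rintegral mu (cyl n x) h.

Definition Delta {R : realType} (mu : {measure set G -> \bar R}) (n : nat)
  (h : G -> R) (x : G) : R :=
  match n with
  | 0 => condE mu 0 h x
  | m.+1 => condE mu m.+1 h x - condE mu m h x
  end.

(* an l^2-valued function f : G -> l^2 is given by its coordinates f n : G -> R *)
Definition l2sq {R : realType} (f : nat -> G -> R) (x : G) : \bar R :=
  (\sum_(0 <= n <oo) ((f n x) ^+ 2)%:E)%E.

Definition Lp_l2 {R : realType} (mu : {measure set G -> \bar R}) (p : R)
  (f : nat -> G -> R) : Prop :=
  (forall n, measurable_fun [set: G] (f n)) /\
  (\int[mu]_x (l2sq f x `^ (p / 2)) < +oo)%E.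

Definition kpair {R : realType} (f : nat -> G -> R) (x y : G) : R :=
  limn (fun N => \sum_(n < N) kappa n y * f n (gsub x y)).

Definition trunc_conv {R : realType} (mu : {measure set G -> \bar R})
  (f : nat -> G -> R) (x : G) (r : R) : \bar R :=
  (\int[mu]_(y in [set y : G | (r <= dist y zeroG)%R]) (kpair f x y)%:E)%E.

Definition PV_to {R : realType} (mu : {measure set G -> \bar R})
  (f : nat -> G -> R) (x : G) (v : R) : Prop :=
  trunc_conv mu f x @ 0^'+ --> v%:E.

(* Main.v *)
Require Import Defs.
From HB Require Import structures.
From mathcomp Require Import all_boot all_order all_algebra.
From mathcomp Require Import all_classical all_reals all_analysis.
From mathcomp Require Import measurable_realfun ring lra.
Import Order.TTheory GRing.Theory Num.Theory.
Import numFieldNormedType.Exports.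
Local Open Scope classical_set_scope.
Local Open Scope ring_scope.

(** With [S_N = \sum_(n < N) Delta_n f_n], the integral of the kernel over the
    complement of the cylinder of length [N] around the identity equals
    [S_(N+1) - e_N], where [e_N] is dominated by the martingale [E_N |f|] and
    tends to [0] almost everywhere.  The increment of [S] is one coordinate of
    the increment of the l^2-valued martingale [E_n f], so [S] is differentially
    subordinate to [E_n f] in the sense of Burkholder.  His special functions
    [burk1] and [burkoo] are concave at midpoints along admissible directions,
    hence give supermartingales on the dyadic tree; stopping the first one yields
    the maximal weak (1,1) inequality, and integrating both families over the
    level [t] yields the L^p bounds.  Applied to the tails [(f_n)_(n >= K)], the
    maximal inequality shows that [S_N] is almost everywhere Cauchy, and Fatou's
    lemma transfers the bounds to the limit. *)

(** Convolution with [kappa n] is [Delta n], so at step [n] the scalar sum moves by coordinate [n]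
    of the vector increment, a different coordinate each time. The sum is not a transform of one
    scalar martingale; what survives is the comparison of the sizes of increments, and this is all
    that Burkholder's functions ask for. Their constants do not see the dimension, so the l^2 norm
    can be cut to finitely many coordinates. Each atom splits into two halves of equal mass, so
    two-point inequalities suffice. Two families are needed because the level inequality from
    [burk1] leaves a term a^2 / t on {t >= a + |y|}, whose integral against d(t^(p-1)) converges
    only for p < 2, while the one from [burkoo] is integrated against d(t^(p-2)), which asks for p >
    2. The error e_N is there because the kernel does not integrate to zero over the removed
    cylinder: each [kappa n] with n <= N is a positive constant on it. The l^2 norm of these
    constants is at most 2^N, the inverse of the mass of the cylinder, hence the domination by E_N
    |f|. *)

(** * Burkholder's special functions and their midpoint concavity *)

Section burkholder_functions.
Context {R : realType}.
Implicit Types t a y k : R.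

(** [a] is the norm of the Hilbert space variable and [y] the scalar one. [burk1] and [burkoo] are
    the degree 2 rescalings to level [t] of Burkholder's functions for the weak-type bound and for
    exponents above 2. In both, the two branches agree on the boundary a + |y| = t. *)
Definition burk1 t a y : R :=
  if a + `|y| <= t then y ^+ 2 - a ^+ 2 else t ^+ 2 - 2 * t * a.

Definition burkoo t a y : R :=
  if a + `|y| <= t then 0 else (`|y| - t) ^+ 2 - a ^+ 2.

(** Inside the cone |y| <= t - a, so the outer branch dominates everywhere. A midpoint lying outside
    the cone can then be treated without asking on which branch the two end points fall. *)
Lemma burk1_le t a y : 0 <= a -> burk1 t a y <= t ^+ 2 - 2 * t * a.
Proof.
move=> a0; rewrite /burk1; case: ifPn => // h.
have yt : y ^+ 2 <= (t - a) ^+ 2.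
  by rewrite -real_normK ?num_real// ler_sqr ?nnegrE//; have := normr_ge0 y; lra.
nra.
Qed.

Lemma burkoo_le t a y : 0 <= a -> burkoo t a y <= (`|y| - t) ^+ 2 - a ^+ 2.
Proof.
move=> a0; rewrite /burkoo; case: ifPn => // h.
have := normr_ge0 y; nra.
Qed.

Lemma burk1_le0 t a y : 0 <= t -> `|y| <= a -> burk1 t a y <= 0.
Proof.
move=> t0 ya; have y0 := normr_ge0 y; rewrite /burk1; case: ifPn => h.
  by rewrite -real_normK ?num_real//; nra.
by rewrite -ltNge in h; nra.
Qed.

Lemma burkoo_le0 t a y : 0 <= t -> `|y| <= a -> burkoo t a y <= 0.
Proof.
by move=> t0 ya; have y0 := normr_ge0 y; rewrite /burkoo; case: ifPn => // h;
   rewrite -ltNge in h; nra.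
Qed.

Lemma burk1_ge t a y : 0 <= t -> 0 <= a -> - (2 * t * a) <= burk1 t a y.
Proof.
move=> t0 a0; rewrite /burk1; case: ifPn => h; last by have := sqr_ge0 t; lra.
have := normr_ge0 y; have := sqr_ge0 y; nra.
Qed.

Lemma burk1_gt t a y : 0 <= a -> t < `|y| ->
  burk1 t a y = t ^+ 2 - 2 * t * a.
Proof. by move=> a0 ty; rewrite /burk1; case: ifPn => // h; lra. Qed.

(* [a], [a1], [a2], [eta] stand for the norms of vectors [x], [x + h], [x - h],
   [h] of a Hilbert space and [be] for the inner product of [x] and [h]. *)
Section midpoint.
Variables (t a a1 a2 eta be y k : R).
Hypotheses (t0 : 0 <= t) (a0 : 0 <= a) (a10 : 0 <= a1) (a20 : 0 <= a2).
Hypotheses (eta0 : 0 <= eta).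
Hypotheses (a1E : a1 ^+ 2 = a ^+ 2 + 2 * be + eta ^+ 2).
Hypotheses (a2E : a2 ^+ 2 = a ^+ 2 - 2 * be + eta ^+ 2).
Hypotheses (beP : `|be| <= a * eta) (kP : `|k| <= eta).

Let be12 : - (a * eta) <= be <= a * eta.
Proof. by move: beP; rewrite ler_norml. Qed.

Lemma norm_le_add : a1 <= a + eta.
Proof.
rewrite -(@ler_pXn2r _ 2) ?nnegrE ?addr_ge0//.
by rewrite a1E; case/andP: be12; nra.
Qed.

Lemma norm_ge_sub : eta - a <= a1.
Proof.
have [h|h] := leP eta a; first by apply: le_trans a10; rewrite subr_le0.
rewrite -(@ler_pXn2r _ 2) ?nnegrE ?subr_ge0 ?(ltW h)//.
by rewrite a1E; case/andP: be12; nra.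
Qed.

Lemma norm_midpoint : 2 * a <= a1 + a2.
Proof.
have aa : a ^+ 2 - eta ^+ 2 <= a1 * a2.
  have [h|h] := leP (a ^+ 2 - eta ^+ 2) 0.
    by apply: (le_trans h); rewrite mulr_ge0.
  rewrite -(@ler_pXn2r _ 2) ?nnegrE ?mulr_ge0 ?(ltW h)// exprMn a1E a2E.
  have b2 : be ^+ 2 <= (a * eta) ^+ 2.
    by rewrite -real_normK ?num_real// ler_sqr ?nnegrE ?mulr_ge0.
  nra.
rewrite -(@ler_pXn2r _ 2) ?nnegrE ?addr_ge0 ?mulr_ge0//.
rewrite (sqrrD a1) a1E a2E exprMn; lra.
Qed.

Let k2 : k ^+ 2 <= eta ^+ 2.
Proof. by rewrite -real_normK ?num_real// ler_sqr ?nnegrE. Qed.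

Let yk : - (`|y| * eta) <= y * k.
Proof.
have : `|y * k| <= `|y| * eta by rewrite normrM ler_wpM2l.
by rewrite ler_norml => /andP[].
Qed.

(** The right-hand side is the value at the midpoint plus terms linear in the displacement. These
    cancel when the bounds for the displacement and its opposite are added. *)
Lemma burk1_inside : a + `|y| <= t ->
  burk1 t a1 (y + k) <= y ^+ 2 - a ^+ 2 + 2 * (y * k) - 2 * be.
Proof.
move=> h; rewrite /burk1; case: ifPn => h1; first by rewrite a1E; have := k2; lra.
rewrite -ltNge in h1.
(* Adding [a1 ^+ 2] to both sides completes the square of the outer branch. *)
suff : (t - a1) ^+ 2 <= y ^+ 2 + 2 * (y * k) + eta ^+ 2 by rewrite sqrrB; have := a1E; lra.
have [a1t|ta1] := leP a1 t.
  apply: (@le_trans _ _ ((y + k) ^+ 2)); last by rewrite sqrrD -mulr_natl; have := k2; lra.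
  rewrite -(real_normK (num_real (y + k))) ler_sqr ?nnegrE//; lra.
(* Here [t < a1]; since the midpoint is inside the cone, [a1 - t <= a + eta - t <= eta - |y|]. *)
apply: (@le_trans _ _ ((eta - `|y|) ^+ 2)).
  rewrite -(sqrrN (t - a1)) ler_sqr ?nnegrE; have := norm_le_add; lra.
by rewrite sqrrB (real_normK (num_real y)) -mulr_natl; have := yk; lra.
Qed.

(** If the end point leaves the cone, then | |y + k| - t | <= [a1]: on one side because it is
    outside, on the other because |y| + eta - t <= eta - a <= [a1]. *)
Lemma burkoo_inside : a + `|y| <= t -> burkoo t a1 (y + k) <= 0.
Proof.
move=> h; rewrite /burkoo; case: ifPn => // h1; rewrite -ltNge in h1.
rewrite subr_le0 -(real_normK (num_real (_ - t))) ler_sqr ?nnegrE//.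
rewrite ler_norml; have := norm_ge_sub; have := ler_normD y k; have := kP; lra.
Qed.

End midpoint.

Lemma burk1_midpoint t a a1 a2 (eta be : R) y k :
  0 <= t -> 0 <= a -> 0 <= a1 -> 0 <= a2 -> 0 <= eta ->
  a1 ^+ 2 = a ^+ 2 + 2 * be + eta ^+ 2 ->
  a2 ^+ 2 = a ^+ 2 - 2 * be + eta ^+ 2 ->
  `|be| <= a * eta -> `|k| <= eta ->
  burk1 t a1 (y + k) + burk1 t a2 (y - k) <= 2 * burk1 t a y.
Proof.
move=> t0 a0 a10 a20 eta0 a1E a2E beP kP.
have [h|h] := leP (a + `|y|) t.
  have := @burk1_inside t a a1 eta be y k a0 a10 eta0 a1E beP kP h.
  have := @burk1_inside t a a2 eta (- be) y (- k) a0 a20 eta0.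
  rewrite mulrN !normrN => /(_ a2E beP kP h).
  by rewrite [burk1 t a y]/burk1 h; lra.
have := burk1_le t a1 (y + k) a10; have := burk1_le t a2 (y - k) a20.
have := @norm_midpoint a a1 a2 eta be a0 a10 a20 eta0 a1E a2E beP.
rewrite [burk1 t a y]/burk1 [a + _ <= t]leNgt h /=; nra.
Qed.

Lemma burkoo_midpoint t a a1 a2 (eta be : R) y k :
  0 <= t -> 0 <= a -> 0 <= a1 -> 0 <= a2 -> 0 <= eta ->
  a1 ^+ 2 = a ^+ 2 + 2 * be + eta ^+ 2 ->
  a2 ^+ 2 = a ^+ 2 - 2 * be + eta ^+ 2 ->
  `|be| <= a * eta -> `|k| <= eta ->
  burkoo t a1 (y + k) + burkoo t a2 (y - k) <= 2 * burkoo t a y.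
Proof.
move=> t0 a0 a10 a20 eta0 a1E a2E beP kP.
have [h|h] := leP (a + `|y|) t.
  have : burkoo t a1 (y + k) <= 0 by apply: (burkoo_inside t a a1 eta be).
  have : burkoo t a2 (y - k) <= 0.
    by apply: (burkoo_inside t a a2 eta (- be)); rewrite ?mulrN ?normrN.
  by rewrite [burkoo t a y]/burkoo h; lra.
have := burkoo_le t a1 (y + k) a10; have := burkoo_le t a2 (y - k) a20.
rewrite [burkoo t a y]/burkoo [a + _ <= t]leNgt h /= !sqrrB !(real_normK (num_real _)) a1E a2E.
have k2 : k ^+ 2 <= eta ^+ 2.
  by rewrite -real_normK ?num_real// ler_sqr ?nnegrE.
have y2 : 2 * `|y| <= `|y + k| + `|y - k|.
  have := ler_normD (y + k) (y - k).
  by rewrite (_ : y + k + (y - k) = 2 * y) ?normrM ?(@ger0_norm _ 2)//; ring.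
nra.
Qed.

End burkholder_functions.

(** * Euclidean norms of truncated sequences *)

Section euclidean_norm.
Context {R : realType}.
Implicit Types u v : nat -> R.

Definition vdot M u v : R := \sum_(i < M) u i * v i.
Definition vnorm M v : R := Num.sqrt (\sum_(i < M) v i ^+ 2).

Lemma vnorm_ge0 M v : 0 <= vnorm M v. Proof. exact: sqrtr_ge0. Qed.

Lemma vnormE M v : vnorm M v ^+ 2 = \sum_(i < M) v i ^+ 2.
Proof. by rewrite sqr_sqrtr// sumr_ge0// => i _; exact: sqr_ge0. Qed.

(** Lagrange's identity: the defect in Cauchy-Schwarz is a sum of squares. The double sum meets
    every pair twice, hence the factor 2 below. *)
Lemma vdot_vnorm M u v : `|vdot M u v| <= vnorm M u * vnorm M v.
Proof.
rewrite -(@ler_pXn2r _ 2) ?nnegrE ?mulr_ge0 ?vnorm_ge0//.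
rewrite exprMn !vnormE real_normK ?num_real//.
have : 0 <= \sum_(i < M) \sum_(j < M) (u i * v j - u j * v i) ^+ 2.
  by apply: sumr_ge0 => i _; apply: sumr_ge0 => j _; exact: sqr_ge0.
suff -> : \sum_(i < M) \sum_(j < M) (u i * v j - u j * v i) ^+ 2 =
  2 * ((\sum_(i < M) u i ^+ 2) * (\sum_(i < M) v i ^+ 2) - vdot M u v ^+ 2).
  by lra.
rewrite (eq_bigr (fun i : 'I_M => \sum_(j < M) (u i ^+ 2 * v j ^+ 2)
   + \sum_(j < M) (v i ^+ 2 * u j ^+ 2)
   - 2 * (\sum_(j < M) ((u i * v i) * (u j * v j))))); last first.
  move=> i _; rewrite mulr_sumr -big_split -sumrB/=; apply: eq_bigr => j _; ring.
rewrite sumrB big_split/= -!mulr_sumr.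
under eq_bigr do rewrite -mulr_sumr.
under [X in _ + X - _]eq_bigr do rewrite -mulr_sumr.
under [X in _ - _ * X]eq_bigr do rewrite -mulr_sumr.
by rewrite -!mulr_suml /vdot; ring.
Qed.

Lemma vnormD M u v : vnorm M (fun i => u i + v i) ^+ 2 =
  vnorm M u ^+ 2 + 2 * vdot M u v + vnorm M v ^+ 2.
Proof.
rewrite !vnormE /vdot mulr_sumr -!big_split/=; apply: eq_bigr => i _; ring.
Qed.

Lemma vnormB M u v : vnorm M (fun i => u i - v i) ^+ 2 =
  vnorm M u ^+ 2 - 2 * vdot M u v + vnorm M v ^+ 2.
Proof.
rewrite !vnormE /vdot mulr_sumr -sumrB -!big_split/=; apply: eq_bigr => i _; ring.
Qed.

Lemma norm_le_vnorm M v (i : nat) : (i < M)%N -> `|v i| <= vnorm M v.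
Proof.
move=> iM; rewrite -(@ler_pXn2r _ 2) ?nnegrE ?vnorm_ge0// vnormE.
rewrite real_normK ?num_real// (bigD1 (Ordinal iM))//= lerDl.
by apply: sumr_ge0 => j _; exact: sqr_ge0.
Qed.

End euclidean_norm.

(** * Averages, supermartingales and stopping on the dyadic tree *)

Section tree_average.
Context {R : realType}.
Implicit Types (Phi Psi : Gc -> R) (x : Gc).

Definition upd x (n : nat) (b : bool) : Gc := fun i => if i == n then b else x i.

Definition depends_on n Phi := forall x y,
  (forall i, (i < n)%N -> x i = y i) -> Phi x = Phi y.

Lemma depends_onW m n Phi : (m <= n)%N -> depends_on m Phi -> depends_on n Phi.
Proof.
by move=> mn h x y xy; apply: h => i im; apply: xy; exact: leq_trans mn.
Qed.

Lemma depends_on_upd n m Phi x b : (n <= m)%N ->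
  depends_on n Phi -> Phi (upd x m b) = Phi x.
Proof.
move=> nm; apply => i iN; rewrite /upd ifN//.
by rewrite ltn_eqF// (leq_trans iN).
Qed.

(* The average of [Phi] over the [2 ^ N] points that vanish from index [N] on. *)
Fixpoint tav N Phi : R := match N with
  | 0 => Phi zeroG
  | n.+1 => tav n (fun x => 2^-1 * (Phi (upd x n false) + Phi (upd x n true)))
  end.

Lemma eq_tav N Phi Psi : Phi =1 Psi -> tav N Phi = tav N Psi.
Proof. by move=> /funext ->. Qed.

Lemma ler_tav N Phi Psi : (forall x, Phi x <= Psi x) -> tav N Phi <= tav N Psi.
Proof.
elim: N Phi Psi => [|N IH] Phi Psi h /=; first exact: h.
apply: IH => x.
by rewrite ler_wpM2l// lerD.
Qed.

Lemma tavD N Phi Psi : tav N (fun x => Phi x + Psi x) = tav N Phi + tav N Psi.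
Proof.
elim: N Phi Psi => [|N IH] Phi Psi //=; rewrite -IH; apply: eq_tav => x; ring.
Qed.

Lemma tavZ N c Phi : tav N (fun x => c * Phi x) = c * tav N Phi.
Proof. elim: N Phi => [|N IH] Phi //=; rewrite -IH; apply: eq_tav => x; ring. Qed.

Definition supermartingale N (U : nat -> Gc -> R) :=
  forall n x, (n < N)%N ->
    U n.+1 (upd x n false) + U n.+1 (upd x n true) <= 2 * U n x.

Lemma tav_supermartingale N U : supermartingale N U -> tav N (U N) <= U 0 zeroG.
Proof.
elim: N => [|N IH] h //=.
apply: le_trans (IH _); last by move=> n x nN; apply: h; exact: ltnW.
by apply: ler_tav => x; have := h N x (ltnSn N); lra.
Qed.

Section doob.
Variables (c : R) (U : nat -> Gc -> R).
Hypotheses (U0 : forall n x, 0 <= U n x).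
Hypothesis dU : forall n, depends_on n (U n).

Fixpoint hit n x : bool :=
  (c <= U n x) || (if n is m.+1 then hit m x else false).

Lemma hitP n x : reflect (exists2 m, (m <= n)%N & c <= U m x) (hit n x).
Proof.
elim: n => [|n IH] /=.
  by rewrite orbF; apply: (iffP idP) => [|[m]]; [exists 0%N|rewrite leqn0 => /eqP ->].
apply: (iffP orP) => [[h|/IH[m mn h]]|[m]].
- by exists n.+1.
- by exists m => //; exact: leqW.
- rewrite leq_eqVlt => /predU1P[-> ?|mn h]; first by left.
  by right; apply/IH; exists m.
Qed.

Lemma depends_on_hit n x y : (forall i, (i < n)%N -> x i = y i) ->
  hit n x = hit n y.
Proof.
elim: n => [|n IH] h /=; first by rewrite (dU 0 _ y).
by rewrite (dU n.+1 _ y)// IH// => i iN; apply: h; exact: ltnW.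
Qed.

Fixpoint stopped n x : R := match n with
  | 0 => U 0 x
  | m.+1 => if hit m x then stopped m x else U m.+1 x
  end.

Lemma depends_on_stopped n : depends_on n (stopped n).
Proof.
elim: n => [|n IH] x y xy /=; first exact: dU.
have xy' i : (i < n)%N -> x i = y i by move=> iN; apply: xy; exact: ltnW.
by rewrite (depends_on_hit _ _ y)// (IH _ y)// (dU n.+1 _ y).
Qed.

Lemma stopped_ge0 n x : 0 <= stopped n x.
Proof. by elim: n => //= n IH; case: ifP. Qed.

Lemma stopped_ge n x : hit n x -> c <= stopped n x.
Proof.
elim: n => [|n IH] /=; first by rewrite orbF.
by case: (hit n x) IH => [IH _|_]; [exact: IH|rewrite orbF].
Qed.

Lemma stopped_nohit n x : ~~ hit n x -> stopped n x = U n x.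
Proof. by case: n => //= n; rewrite negb_or => /andP[_ /negbTE ->]. Qed.

(** [hit n] reads only the coordinates below [n], so the two children of a node are frozen together:
    a frozen node passes its value on unchanged, any other inherits the inequality of [U]. *)
Lemma stopped_supermartingale N : supermartingale N U -> supermartingale N stopped.
Proof.
move=> h n x nN /=.
have hb b : hit n (upd x n b) = hit n x.
  by apply: depends_on_hit => i iN; rewrite /upd ifN// ltn_eqF.
rewrite !hb; case: ifPn => hx.
  rewrite !(depends_on_upd n n (stopped n))//; [lra|exact: depends_on_stopped..].
by rewrite stopped_nohit//; exact: h.
Qed.

Lemma tav_doob N : supermartingale N U ->
  tav N (fun x => c * (hit N x)%:R) <= U 0 zeroG.
Proof.
move=> /stopped_supermartingale /tav_supermartingale; apply: le_trans.
apply: ler_tav => x; case: (boolP (hit N x)) => hx.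
  by rewrite mulr1; exact: stopped_ge.
by rewrite mulr0 stopped_ge0.
Qed.

End doob.
End tree_average.

(** * Cylinders and functions of finitely many coordinates *)

Section cylinder_sets.

Lemma cylinder_measurable n (a : Gc) : measurable (cyl n a : set G).
Proof. by apply: sub_sigma_algebra; exists n, a. Qed.

Lemma eq_cyl n (a b : Gc) : (forall i, (i < n)%N -> a i = b i) ->
  cyl n a = cyl n b.
Proof.
by move=> ab; apply/seteqP; split => x h i iN; rewrite h// ab.
Qed.

Lemma cyl0 (a : Gc) : cyl 0 a = setT.
Proof. by apply/seteqP; split. Qed.

Lemma cyl_split n (x : Gc) :
  cyl n x = cyl n.+1 (upd x n false) `|` cyl n.+1 (upd x n true).
Proof.
apply/seteqP; split=> y.
  move=> h; case yn : (y n); [right|left] => i; rewrite ltnS leq_eqVlt /upd;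
  by case: eqP => [->|_ /=] //; exact: h.
by move=> [] h i iN; rewrite (h i (ltnW iN)) /upd ltn_eqF.
Qed.

Lemma cyl_disj n (x : Gc) :
  [disjoint cyl n.+1 (upd x n false) & cyl n.+1 (upd x n true)].
Proof.
apply/disj_setPS => y [/(_ n (ltnSn n)) + /(_ n (ltnSn n))].
by rewrite /upd eqxx => ->.
Qed.

Definition prolong n (w : {ffun 'I_n -> bool}) : Gc :=
  fun i => if insub i is Some j then w j else false.

Definition trace n (x : Gc) : {ffun 'I_n -> bool} := [ffun i : 'I_n => x i].

Lemma prolongK n x i : (i < n)%N -> prolong n (trace n x) i = x i.
Proof. by move=> iN; rewrite /prolong insubT /= ffunE. Qed.

(** Only 2^n patterns of coordinates occur, so every preimage is a finite union of cylinders. The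
    target is left general to cover both real functions and boolean events. *)
Lemma depends_on_measurable d (T : measurableType d) n (phi : G -> T) :
  (forall x y : G, (forall i, (i < n)%N -> x i = y i) -> phi x = phi y) ->
  measurable_fun [set: G] phi.
Proof.
move=> dphi _ B mB; rewrite setTI.
have -> : phi @^-1` B =
    \bigcup_(w in [set w | B (phi (prolong n w))]) cyl n (prolong n w).
  apply/seteqP; split => [x Bx|x [w /= Bw] wx].
    exists (trace n x) => /=.
      by rewrite (dphi _ x)// => i iN; exact: prolongK.
    by move=> i iN; rewrite prolongK.
  by rewrite /preimage /= (dphi _ (prolong n w)).
apply: fin_bigcup_measurable; first exact: finite_finset.
by move=> w _; exact: cylinder_measurable.
Qed.

Lemma depends_on_bounded (R : realType) n (phi : G -> R) : depends_on n phi ->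
  exists2 M, 0 <= M & forall x, `|phi x| <= M.
Proof.
move=> dphi; exists (\sum_w `|phi (prolong n w)|); first exact: sumr_ge0.
move=> x; rewrite (bigD1 (trace n x))//= (dphi _ x) ?lerDl ?sumr_ge0//.
by move=> i iN; exact: prolongK.
Qed.

End cylinder_sets.

(** * Conditional expectations for Haar measure *)

Section conditional_expectation.
Context {R : realType} (mu : {measure set G -> \bar R}).
Hypothesis haar_mu : haar mu.
Implicit Types (phi psi : G -> R) (x : G).

Let intg phi := mu.-integrable [set: G] (EFin \o phi).

Lemma haarT : mu setT = 1%E.
Proof. by rewrite -(cyl0 zeroG) haar_mu expr0. Qed.

Lemma bounded_integrable phi (M : R) : measurable_fun [set: G] phi ->
  (forall x, `|phi x| <= M) -> intg phi.
Proof.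
move=> mphi phiM; apply: measurable_bounded_integrable => //.
  by rewrite haarT ltry.
exists M; split; first exact: num_real.
by move=> e Me x _ /=; apply: le_trans (ltW Me).
Qed.

Lemma depends_on_integrable n phi : depends_on n phi -> intg phi.
Proof.
move=> dphi; have [M M0 phiM] := depends_on_bounded _ _ _ dphi.
by apply: bounded_integrable phiM; exact: depends_on_measurable dphi.
Qed.

Lemma integrable_cyl n x phi : intg phi -> mu.-integrable (cyl n x) (EFin \o phi).
Proof. by apply: integrableS => //; exact: cylinder_measurable. Qed.

Lemma depends_on_condE n phi : depends_on n (condE mu n phi).
Proof. by move=> x y xy; rewrite /condE (eq_cyl n x y). Qed.

Lemma condE_cst n x (c : R) : condE mu n (fun=> c) x = c.
Proof.
rewrite /condE Rintegral_cst; last exact: cylinder_measurable.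
by rewrite [mu _]haar_mu /= mulrCA -exprMn divff// expr1n mulr1.
Qed.

Lemma condE_depends_on n phi x : depends_on n phi -> condE mu n phi x = phi x.
Proof.
move=> dphi; rewrite -[RHS](condE_cst n x) /condE; congr (_ * _).
by apply: eq_Rintegral => y; rewrite inE => yx; exact: dphi.
Qed.

Lemma condE_half n phi x : intg phi ->
  condE mu n.+1 phi (upd x n false) + condE mu n.+1 phi (upd x n true) =
  2 * condE mu n phi x.
Proof.
move=> iphi; rewrite /condE -mulrDr -Rintegral_setU.
- by rewrite -cyl_split exprS mulrA.
- exact: cylinder_measurable.
- exact: cylinder_measurable.
- by rewrite -cyl_split; exact: integrable_cyl.
- exact: cyl_disj.
Qed.

Lemma condE0 phi x : condE mu 0 phi x = \int[mu]_y phi y.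
Proof. by rewrite /condE expr0 mul1r cyl0. Qed.

Lemma tav_condE N phi : intg phi -> tav N (condE mu N phi) = \int[mu]_x phi x.
Proof.
move=> iphi; elim: N => [|N IH] /=; first exact: condE0.
rewrite -IH; apply: eq_tav => x; rewrite condE_half//.
by rewrite mulrA mulVf// mul1r.
Qed.

(** This trades the measure for a finite tree, where the two-point inequalities can be summed level
    by level. *)
Lemma Rintegral_tav N phi : depends_on N phi -> \int[mu]_x phi x = tav N phi.
Proof.
move=> dphi; rewrite -(tav_condE N); last exact: depends_on_integrable dphi.
by apply: eq_tav => x; exact: condE_depends_on.
Qed.

Lemma measure_tav N (P : G -> bool) :
  (forall x y : G, (forall i, (i < N)%N -> x i = y i) -> P x = P y) ->
  mu [set x | P x] = (tav N (fun x => (P x)%:R))%:E.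
Proof.
move=> dP; have mP : measurable [set x | P x].
  have := depends_on_measurable _ _ N P dP measurableT [set true] I.
  by rewrite setTI.
rewrite -(Rintegral_tav N); last by move=> x y xy; rewrite (dP x y).
rewrite /Rintegral fineK; last first.
  apply: integrable_fin_num => //.
  by apply: (depends_on_integrable N) => x y xy; rewrite (dP x y).
rewrite -(setIT [set x | P x]) -integral_indic//; apply: eq_integral => x _ /=.
by rewrite indicE mem_setE.
Qed.

Lemma ler_condE n phi psi x : intg phi -> intg psi ->
  (forall y, phi y <= psi y) -> condE mu n phi x <= condE mu n psi x.
Proof.
move=> iphi ipsi h; apply: ler_wpM2l; first exact: exprn_ge0.
by apply: le_Rintegral => //; [exact: cylinder_measurable|exact: integrable_cyl..].
Qed.

Lemma condE_ge0 n phi x : (forall y, 0 <= phi y) -> 0 <= condE mu n phi x.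
Proof.
by move=> h; rewrite mulr_ge0 ?exprn_ge0// Rintegral_ge0.
Qed.

Lemma norm_condE n phi x : intg phi ->
  `|condE mu n phi x| <= condE mu n (fun y => `|phi y|) x.
Proof.
move=> iphi; rewrite normrM ger0_norm ?exprn_ge0// ler_wpM2l ?exprn_ge0//.
by apply: le_normr_Rintegral; [exact: cylinder_measurable|exact: integrable_cyl].
Qed.

Lemma intgZ (c : R) phi : intg phi -> intg (fun x => c * phi x).
Proof.
by move=> iphi; exact: (integrableZl measurableT c iphi).
Qed.

Lemma intgD phi psi : intg phi -> intg psi -> intg (fun x => phi x + psi x).
Proof.
by move=> iphi ipsi; exact: (integrableD measurableT iphi ipsi).
Qed.

Lemma condEZ n c phi x : intg phi ->
  condE mu n (fun y => c * phi y) x = c * condE mu n phi x.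
Proof.
move=> iphi; rewrite /condE RintegralZl; first by rewrite mulrCA.
  exact: cylinder_measurable.
exact: integrable_cyl.
Qed.

Lemma condED n phi psi x : intg phi -> intg psi ->
  condE mu n (fun y => phi y + psi y) x = condE mu n phi x + condE mu n psi x.
Proof.
move=> iphi ipsi; rewrite /condE RintegralD; first by rewrite mulrDr.
- exact: cylinder_measurable.
- exact: integrable_cyl.
- exact: integrable_cyl.
Qed.

Lemma intg_lincomb M (c : nat -> R) (f : nat -> G -> R) : (forall i, intg (f i)) ->
  intg (fun y => \sum_(i < M) c i * f i y).
Proof.
move=> fi; elim: M => [|M IH].
  under eq_fun do rewrite big_ord0.
  exact: (depends_on_integrable 0).
under eq_fun do rewrite big_ord_recr /=.
by apply: intgD => //; exact: intgZ.
Qed.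

Lemma condE_lincomb n M (c : nat -> R) (f : nat -> G -> R) x :
  (forall i, intg (f i)) ->
  condE mu n (fun y => \sum_(i < M) c i * f i y) x =
  \sum_(i < M) c i * condE mu n (f i) x.
Proof.
move=> fi; elim: M => [|M IH].
  under eq_fun do rewrite big_ord0.
  by rewrite condE_cst big_ord0.
under eq_fun do rewrite big_ord_recr /=.
rewrite condED; [|exact: intg_lincomb|exact: intgZ].
by rewrite IH condEZ// big_ord_recr.
Qed.

Lemma vnorm_le_sum M (v : nat -> R) : vnorm M v <= \sum_(i < M) `|v i|.
Proof.
rewrite -(@ler_pXn2r _ 2) ?nnegrE ?vnorm_ge0 ?sumr_ge0// vnormE.
elim: M => [|M IH]; first by rewrite !big_ord0 expr2 mulr0.
rewrite !big_ord_recr /= sqrrD real_normK ?num_real// lerD2r.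
by rewrite (le_trans IH)// lerDl mulrn_wge0// mulr_ge0// sumr_ge0.
Qed.

Lemma measurable_vnorm M (f : nat -> G -> R) :
  (forall i, measurable_fun [set: G] (f i)) ->
  measurable_fun [set: G] (fun y => vnorm M (f ^~ y)).
Proof.
move=> mf; rewrite /vnorm.
have msqrt : measurable_fun [set: R] (@Num.sqrt R).
  by apply: continuous_measurable_fun; exact: sqrt_continuous.
apply: (measurableT_comp msqrt).
by apply: measurable_sum => i; apply: measurable_funX.
Qed.

Lemma intg_measurable phi : intg phi -> measurable_fun [set: G] phi.
Proof. by move=> /measurable_int /measurable_EFinP. Qed.

Lemma intg_le phi psi : measurable_fun [set: G] phi ->
  (forall x, `|phi x| <= psi x) -> intg psi -> intg phi.
Proof.
move=> mphi h; apply: le_integrable => //; first exact/measurable_EFinP.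
by move=> x _ /=; rewrite lee_fin (le_trans (h x))// ler_norm.
Qed.

Lemma intg_norm phi : intg phi -> intg (fun y => `|phi y|).
Proof. by move=> /integrable_norm. Qed.

Lemma intg_vnorm M (f : nat -> G -> R) : (forall i, intg (f i)) ->
  intg (fun y => vnorm M (f ^~ y)).
Proof.
move=> fi; apply: (intg_le _ (fun y => \sum_(i < M) 1 * `|f i y|)).
- by apply: measurable_vnorm => i; exact: intg_measurable.
- move=> x; rewrite ger0_norm ?vnorm_ge0// (le_trans (vnorm_le_sum _ _))//.
  by under [leRHS]eq_bigr do rewrite mul1r.
- apply: (intg_lincomb M (fun=> 1) (fun i y => `|f i y|)) => i.
  exact: intg_norm.
Qed.

(* The vector-valued triangle inequality: pair the mean with itself. *)
Lemma vnorm_condE n M (f : nat -> G -> R) x : (forall i, intg (f i)) ->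
  vnorm M (fun i => condE mu n (f i) x) <= condE mu n (fun y => vnorm M (f ^~ y)) x.
Proof.
move=> fi; set v := fun i => condE mu n (f i) x.
have [->|v0] := eqVneq (vnorm M v) 0.
  by apply: condE_ge0 => y; exact: vnorm_ge0.
rewrite -(@ler_pM2l _ (vnorm M v)) ?lt_def ?v0 ?vnorm_ge0//.
rewrite -expr2 vnormE -condEZ; last exact: intg_vnorm.
under eq_bigr do rewrite expr2.
rewrite -condE_lincomb//; apply: ler_condE.
- exact: intg_lincomb.
- by apply: intgZ; exact: intg_vnorm.
- by move=> y; apply: le_trans (vdot_vnorm M v (f ^~ y)); exact: ler_norm.
Qed.

(** Young's inequality for [phi y] and [c ^ (p - 1)], with [c] the conditional mean, is averaged
    over the atom: the left side becomes c^p, and the share (p - 1) / p of it on the right is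
    subtracted. *)
Lemma condE_jensen n (p : R) phi x : 1 < p -> (forall y, 0 <= phi y) ->
  intg phi -> intg (fun y => phi y `^ p) ->
  condE mu n phi x `^ p <= condE mu n (fun y => phi y `^ p) x.
Proof.
move=> p1 phi0 iphi ip; set c := condE mu n phi x.
have c0 : 0 <= c by exact: condE_ge0.
have p0 : 0 < p by rewrite (lt_trans _ p1).
have pm : 0 < p - 1 by rewrite subr_gt0.
have H y : phi y * c `^ (p - 1) <= phi y `^ p / p + c `^ p * ((p - 1) / p).
  have := @conjugate_powR R (phi y) (c `^ (p - 1)) p (p / (p - 1))
    (phi0 y) (powR_ge0 _ _) p0 (divr_gt0 p0 pm).
  rewrite -powRrM mulrCA divff ?gt_eqF// mulr1 invf_div; apply.
  by field; rewrite gt_eqF.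
have := @ler_condE n (fun y => c `^ (p - 1) * phi y)
  (fun y => p^-1 * phi y `^ p + c `^ p * ((p - 1) / p)) x.
rewrite condEZ// condED; last 2 first.
- exact: intgZ.
- exact: (depends_on_integrable 0).
rewrite condE_cst condEZ// -/c [_ * c]mulrC mulr_powRB1// => /(_ (intgZ _ _ iphi)).
have i2 : intg (fun y => p^-1 * phi y `^ p + c `^ p * ((p - 1) / p)).
  by apply: intgD; [exact: intgZ|exact: (depends_on_integrable 0)].
move=> /(_ i2) hh.
have : c `^ p <= p^-1 * condE mu n (fun y => phi y `^ p) x + c `^ p * ((p - 1) / p).
  by apply: hh => y; rewrite mulrC [p^-1 * _]mulrC.
rewrite -lerBlDr (_ : c `^ p - _ = p^-1 * c `^ p); last by field; rewrite gt_eqF.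
by rewrite ler_pM2l// invr_gt0.
Qed.

End conditional_expectation.

(** * Doob's maximal inequality and its passage to infinitely many levels *)

Section maximal_inequalities.
Context {R : realType} (mu : {measure set G -> \bar R}).
Hypothesis haar_mu : haar mu.

Lemma exists_ge_hit N (c : R) (U : nat -> G -> R) :
  [set x : G | exists2 n, (n <= N)%N & c <= U n x] = [set x | hit c U N x].
Proof. by apply/seteqP; split => x; [move/hitP|move=> /hitP]. Qed.

Lemma measurable_exists_ge N (c : R) (U : nat -> G -> R) :
  (forall n, depends_on n (U n)) ->
  measurable [set x : G | exists2 n, (n <= N)%N & c <= U n x].
Proof.
move=> dU; rewrite exists_ge_hit.
have := depends_on_measurable _ _ N (hit c U N) (depends_on_hit c U dU N).
by move=> /(_ measurableT [set true] I); rewrite setTI.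
Qed.

Lemma doob_maximal N (c : R) (U : nat -> G -> R) : (forall n x, 0 <= U n x) ->
  (forall n, depends_on n (U n)) -> supermartingale N U ->
  (c%:E * mu [set x | exists2 n, (n <= N)%N & (c <= U n x)%R] <= (U 0 zeroG)%:E)%E.
Proof.
move=> U0 dU sU.
rewrite exists_ge_hit (measure_tav _ haar_mu N) -?EFinM ?lee_fin -?tavZ; first exact: tav_doob.
by move=> x y xy; exact: depends_on_hit.
Qed.

Lemma measurable_exists_gt (P : nat -> Prop) (t : R) (Z : nat -> G -> R) :
  (forall n, measurable_fun [set: G] (Z n)) ->
  measurable [set x | exists2 n, P n & t < `|Z n x|].
Proof.
move=> mZ; have -> : [set x | exists2 n, P n & t < `|Z n x|] =
    \bigcup_(n in P) [set x | t < `|Z n x|].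
  by apply/seteqP; split => x [n Pn h]; exists n.
apply: bigcup_measurable => n _.
have := @measurable_fun_ltr _ _ _ _ _ _ (measurable_cst t)
  (measurableT_comp (@normr_measurable R setT) (mZ n)).
by move=> /(_ measurableT [set true] I); rewrite setTI.
Qed.

Lemma maximal_limit (t : R) (Z : nat -> G -> R) (K : \bar R) : 0 < t ->
  (forall n, measurable_fun [set: G] (Z n)) ->
  (forall N, (t%:E * mu [set x | exists2 n, (n <= N)%N & (t < `|Z n x|)%R] <= K)%E) ->
  (t%:E * mu [set x | exists n, (t < `|Z n x|)%R] <= K)%E.
Proof.
move=> t0 mZ H.
pose E N := [set x | exists2 n, (n <= N)%N & t < `|Z n x|].
have mE N : measurable (E N) by exact: measurable_exists_gt.
have EU : [set x | exists n, t < `|Z n x|] = \bigcup_N E N.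
  by apply/seteqP; split => [x [n h]|x [N _ [n _ h]]]; exists n => //; exists n.
have c : (fun N => t%:E * mu (E N))%E @ \oo --> (t%:E * mu (\bigcup_N E N))%E.
  apply: cvgeZl => //; apply: nondecreasing_cvg_mu => //.
    exact: bigcup_measurable.
  move=> m n mn; apply/subsetPset => x [i im h]; exists i => //.
  exact: leq_trans mn.
rewrite EU -(cvg_lim _ c)//; apply: lime_le; first by apply/cvg_ex; eexists; exact: c.
by apply: nearW => N; exact: H.
Qed.

End maximal_inequalities.

(** * Differential subordination and the weak-type bound at a finite level *)

Section martingale_pair.
Context {R : realType} (mu : {measure set G -> \bar R}).
Hypothesis haar_mu : haar mu.
Variable f : nat -> G -> R.
Hypothesis fi : forall i, mu.-integrable [set: G] (EFin \o f i).

Definition psum N (x : G) : R := \sum_(n < N) Delta mu n (f n) x.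

Lemma depends_on_Delta n m (h : G -> R) : (n <= m)%N -> depends_on m (Delta mu n h).
Proof.
move=> nm x y xy.
have d k : (k <= n)%N -> condE mu k h x = condE mu k h y.
  move=> kn; apply: (depends_onW k m) xy; first exact: leq_trans nm.
  exact: depends_on_condE.
by case: n nm d => [|n] nm d /=; rewrite !d.
Qed.

(** The last term of [psum n.+1] is Delta_n, so it is [psum n.+1] that stands at time [n] beside the
    martingale E_n f. This shift recurs in all that follows. *)
Lemma depends_on_psum n : depends_on n (psum n.+1).
Proof.
move=> x y xy; apply: eq_bigr => -[i iN] _ /=.
by apply: (depends_on_Delta i n) xy; rewrite -ltnS.
Qed.

Lemma measurable_psum n : measurable_fun [set: G] (psum n).
Proof.
apply: (depends_on_measurable _ _ n); apply: (depends_onW n.-1); first exact: leq_pred.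
case: n => [|n]; last exact: depends_on_psum.
by move=> x y _; rewrite /psum !big_ord0.
Qed.

Lemma psum_upd n x b : psum n.+2 (upd x n b) =
  psum n.+1 x + (condE mu n.+1 (f n.+1) (upd x n b) - condE mu n (f n.+1) x).
Proof.
rewrite /psum big_ord_recr /= -/(psum n.+1 _); congr (_ + (_ - _)).
  by apply: depends_on_upd; [exact: leqnn|exact: depends_on_psum].
by apply: depends_on_upd; [exact: leqnn|exact: depends_on_condE].
Qed.

Definition mnorm M n (x : G) : R := vnorm M (fun i => condE mu n (f i) x).

Lemma depends_on_mnorm M n : depends_on n (mnorm M n).
Proof.
move=> x y xy; rewrite /mnorm; congr vnorm; apply/funext => i.
exact: depends_on_condE.
Qed.

(* The increment of [psum] is one of the coordinates of the increment of the
   l^2-valued martingale: [psum] is differentially subordinate to it. *)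
Lemma midpoint_step (B : R -> R -> R) M n x : (n.+1 < M)%N ->
  (forall a a1 a2 eta be y k : R,
    0 <= a -> 0 <= a1 -> 0 <= a2 -> 0 <= eta ->
    a1 ^+ 2 = a ^+ 2 + 2 * be + eta ^+ 2 ->
    a2 ^+ 2 = a ^+ 2 - 2 * be + eta ^+ 2 ->
    `|be| <= a * eta -> `|k| <= eta ->
    B a1 (y + k) + B a2 (y - k) <= 2 * B a y) ->
  B (mnorm M n.+1 (upd x n false)) (psum n.+2 (upd x n false)) +
  B (mnorm M n.+1 (upd x n true)) (psum n.+2 (upd x n true)) <=
  2 * B (mnorm M n x) (psum n.+1 x).
Proof.
move=> nM HB; rewrite !psum_upd.
pose u i := condE mu n (f i) x.
pose h i := condE mu n.+1 (f i) (upd x n false) - u i.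
have uT i : condE mu n.+1 (f i) (upd x n true) = u i - h i.
  have := condE_half mu n (f i) x (fi i).
  by rewrite /h /u => H; lra.
rewrite uT (_ : u n.+1 - h n.+1 - _ = - h n.+1); last by rewrite /u addrAC subrr add0r.
apply: (HB _ _ _ (vnorm M h) (vdot M u h)).
- exact: vnorm_ge0.
- exact: vnorm_ge0.
- exact: vnorm_ge0.
- exact: vnorm_ge0.
- rewrite /mnorm -vnormD; congr (vnorm M _ ^+ 2); apply/funext => i.
  by rewrite /h addrC subrK.
- by rewrite /mnorm -vnormB; congr (vnorm M _ ^+ 2); apply/funext => i.
- exact: vdot_vnorm.
(* The bound [n.+1 < M] keeps the coordinate that moves [psum] inside the truncated norm. *)
- exact: norm_le_vnorm.
Qed.

Lemma psum0_le M x : (0 < M)%N -> `|psum 1 x| <= mnorm M 0 x.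
Proof.
move=> M0; rewrite /psum big_ord_recl big_ord0 addr0 /=.
exact: (norm_le_vnorm M (fun i => condE mu 0 (f i) x)).
Qed.

Lemma weak_type_finite N (t : R) : 0 < t ->
  (t%:E * mu [set x | exists2 n, (n <= N)%N & (t < `|psum n.+1 x|)%R] <=
   (2 * \int[mu]_x vnorm N.+1 (f ^~ x))%:E)%E.
Proof.
move=> t0; set F := fun x => vnorm N.+1 (f ^~ x).
have iF : mu.-integrable [set: G] (EFin \o F) by exact: intg_vnorm.
have F0 x : 0 <= F x by exact: vnorm_ge0.
(* Doob's inequality needs a nonnegative process. [burk1] is at least -2ta with a = |E_n f| <= E_n
   |f|, so adding the martingale 2t E_n |f| repairs the sign. It also lifts the value to at least
   t^2 wherever |S| > t, while the start is at most 2t times the integral of |f|; dividing by [t]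
   leaves the constant 2. *)
pose U n x := burk1 t (mnorm N.+1 n x) (psum n.+1 x) + 2 * t * condE mu n F x.
have XF n x : mnorm N.+1 n x <= condE mu n F x by exact: vnorm_condE.
have U0 n x : 0 <= U n x.
  have := burk1_ge t (mnorm N.+1 n x) (psum n.+1 x) (ltW t0) (vnorm_ge0 _ _).
  by have := XF n x; rewrite /U; nra.
have dU n : depends_on n (U n).
  move=> x y xy; rewrite /U (depends_on_mnorm _ _ _ y)// (depends_on_psum _ _ y)//.
  by rewrite (depends_on_condE _ _ _ x y).
have sU : supermartingale N U.
  move=> n x nN; rewrite /U.
  have := midpoint_step (burk1 t) N.+1 n x nN
    (fun a a1 a2 eta be y k => burk1_midpoint t a a1 a2 eta be y k (ltW t0)).
  by have := condE_half mu n F x iF; nra.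
have := doob_maximal _ haar_mu N (t ^+ 2) U U0 dU sU.
have U00 : ((U 0 zeroG)%:E <= (t * (2 * \int[mu]_x F x))%:E)%E.
  rewrite lee_fin /U condE0.
  have := burk1_le0 t (mnorm N.+1 0 zeroG) (psum 1 zeroG) (ltW t0) (psum0_le _ _ (ltn0Sn _)).
  by lra.
move=> H; have {}H := le_trans H U00.
rewrite -(@lee_pmul2l _ t%:E)// -EFinM; apply: le_trans H.
rewrite muleA -EFinM -expr2 lee_pmul2l ?lte_fin ?exprn_gt0//.
apply: le_measure; rewrite ?inE.
- apply: (measurable_exists_gt _ _ (fun n => psum n.+1)) => n; exact: measurable_psum.
- exact: measurable_exists_ge.
- move=> x [n nN h]; exists n => //; rewrite /U burk1_gt//; last exact: vnorm_ge0.
  by have := XF n x; nra.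
Qed.

End martingale_pair.

(** * From inequalities at each level to power inequalities *)

Section tav_integral.
Context d (T : measurableType d) (R : realType) (m : {measure set T -> \bar R}).
Variables (D : set T) (mD : measurable D).

(** A tree average is a finite combination of values, so linearity of the integral takes the place
    of Fubini's theorem. *)
Lemma tav_Rintegral N (Phi : T -> Gc -> R) :
  (forall x, m.-integrable D (EFin \o (Phi ^~ x))) ->
  m.-integrable D (EFin \o (fun u => tav N (Phi u))) /\
  \int[m]_(u in D) tav N (Phi u) = tav N (fun x => \int[m]_(u in D) Phi u x).
Proof.
elim: N Phi => [|N IH] Phi iPhi /=; first by split.
pose Psi u x := 2^-1 * (Phi u (upd x N false) + Phi u (upd x N true)).
have iD x : m.-integrable D
    (EFin \o (fun u => Phi u (upd x N false) + Phi u (upd x N true))).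
  exact: (integrableD mD (iPhi (upd x N false)) (iPhi (upd x N true))).
have iPsi x : m.-integrable D (EFin \o (Psi ^~ x)).
  exact: (integrableZl mD 2^-1 (iD x)).
have [i E] := IH Psi iPsi; split; first exact: i.
rewrite E; apply: eq_tav => x; rewrite -RintegralD//.
by rewrite -RintegralZl//; exact: iD.
Qed.

Lemma ler_tav_Rintegral N (Phi Psi : T -> Gc -> R) :
  (forall x, m.-integrable D (EFin \o (Phi ^~ x))) ->
  (forall x, m.-integrable D (EFin \o (Psi ^~ x))) ->
  (forall u, D u -> tav N (Phi u) <= tav N (Psi u)) ->
  tav N (fun x => \int[m]_(u in D) Phi u x) <=
  tav N (fun x => \int[m]_(u in D) Psi u x).
Proof.
move=> iPhi iPsi h.
have [i1 <-] := tav_Rintegral N _ iPhi; have [i2 <-] := tav_Rintegral N _ iPsi.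
exact: le_Rintegral.
Qed.

End tav_integral.

Section integration_over_levels.
Context {R : realType}.
Notation leb := (@lebesgue_measure R).
Implicit Types (K r : R).

Lemma bounded_integrable_itv K (h : R -> R) (M : R) :
  measurable_fun [set: R] h -> (forall u : R, u \in `[0, K] -> `|h u| <= M) ->
  leb.-integrable `[0, K] (EFin \o h).
Proof.
move=> mh hM; apply: measurable_bounded_integrable => //.
- by rewrite /= lebesgue_measure_itv /=; case: ifP => // _; rewrite -EFinB ltry.
- exact: measurable_funTS.
- exists M; split; first exact: num_real.
  by move=> e Me u uK /=; apply: le_trans (ltW Me); exact: hM.
Qed.

Lemma measurable_ltr r : measurable_fun [set: R] (fun u : R => (u < r)%R%:R : R).
Proof.
have -> : (fun u : R => (u < r)%R%:R : R) = \1_(`]-oo, r[%classic).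
  by apply/funext => u; rewrite indicE mem_setE in_itv.
exact: measurable_indic.
Qed.

Lemma integrable_ltr K r :
  leb.-integrable `[0, K] (EFin \o (fun u : R => (u < r)%R%:R)).
Proof.
apply: (bounded_integrable_itv _ _ 1); first exact: measurable_ltr.
by move=> u _; case: (u < r); rewrite ?normr1 ?normr0.
Qed.

(** The layer-cake formula. The levels are cut at some [K] above all the values met, which keeps the
    integrands integrable. *)
Lemma Rintegral_ltr K r : 0 <= r <= K ->
  \int[leb]_(u in `[0, K]) (u < r)%R%:R = r.
Proof.
move=> /andP[r0 rK]; rewrite /Rintegral.
transitivity (fine (\int[leb]_(u in `[0%R, K]) (\1_(`]-oo, r[%classic) u)%:E)%E).
  by congr fine; apply: eq_integral => u _; rewrite indicE mem_setE in_itv.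
rewrite integral_indic//=.
rewrite (_ : _ `&` _ = `[0, r[%classic); last first.
  apply/seteqP; split => u /=; rewrite !in_itv/=; first by move=> [->/andP[->]].
  by move=> /andP[-> ur]; rewrite ur (le_trans (ltW ur)).
rewrite lebesgue_measure_itv /= lte_fin.
by case: ltP => [_|r0']; [rewrite -EFinB/= subr0|apply/le_anti; rewrite r0].
Qed.

Lemma powR_lt_iff (s u r : R) : 0 < s -> 0 <= u -> 0 <= r ->
  (u `^ s^-1 < r) = (u < r `^ s).
Proof.
move=> s0 u0 r0; have si0 : 0 < s^-1 by rewrite invr_gt0.
apply/idP/idP => h.
  have := gt0_ltr_powR s0 _ _ h; rewrite !nnegrE powR_ge0 r0 => /(_ isT isT).
  by rewrite -powRrM mulVf ?gt_eqF// powRr1.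
have := gt0_ltr_powR si0 _ _ h; rewrite !nnegrE powR_ge0 u0 => /(_ isT isT).
by rewrite -powRrM mulfV ?gt_eqF// powRr1.
Qed.

Lemma powR_continuous_gt0 (e x : R) : 0 < x -> {for x, continuous (fun y : R => y `^ e)}.
Proof.
move=> x0; apply: differentiable_continuous; apply/derivable1_diffP.
by apply: derivable_powR; rewrite in_itv/= x0.
Qed.

Lemma Rintegral_powR_le (K r be : R) : 0 < r -> r < K -> 1 < be ->
  \int[leb]_(u in `[r, K]) u `^ (- be) <= r `^ (1 - be) / (be - 1).
Proof.
move=> r0 rK be1.
have be1' : 0 < be - 1 by rewrite subr_gt0.
pose h (u : R) : R := (1 - be) * u `^ (- be).
have pos u : u \in `[r, K] -> 0 < u.
  by rewrite in_itv/= => /andP[ru _]; exact: lt_le_trans ru.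
have ch u : u \in `[r, K] -> {for u, continuous h}.
  by move=> /pos u0; apply: continuousM; [exact: cvg_cst|exact: powR_continuous_gt0].
have chw : {within `[r, K], continuous h} by exact: continuous_subspace_itv.
have := @continuous_FTC2 R h (fun v : R => v `^ (1 - be)) r K rK chw.
have dF : derivable_oo_LRcontinuous (fun v : R => v `^ (1 - be)) r K.
  split.
  - move=> u; rewrite in_itv/= => /andP[ru _].
    by apply: derivable_powR; rewrite in_itv/= (lt_trans r0).
  - by apply: cvg_at_right_filter; exact: powR_continuous_gt0.
  - by apply: cvg_at_left_filter; apply: powR_continuous_gt0; exact: lt_trans rK.
move=> /(_ dF) FTC.
have : {in `]r, K[, ((fun v : R => v `^ (1 - be))^`())%classic =1 h}.
  move=> u; rewrite in_itv/= => /andP[ru _].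
  rewrite powR_derive1 ?in_itv/= ?(lt_trans r0)// /h; congr (_ * _ `^ _); lra.
move=> /FTC {}FTC.
have ih : leb.-integrable `[r, K] (EFin \o (fun u => u `^ (- be))).
  apply: continuous_compact_integrable; first exact: segment_compact.
  apply: continuous_subspace_itv => u /pos u0; exact: powR_continuous_gt0.
have : \int[leb]_(u in `[r, K]) h u = K `^ (1 - be) - r `^ (1 - be).
  by rewrite /Rintegral FTC.
rewrite /h RintegralZl// => E.
by rewrite ler_pdivlMr// mulrC -opprB mulNr E opprB lerBlDr lerDl powR_ge0.
Qed.

End integration_over_levels.

Section lp_from_levels.
Context {R : realType}.
Notation leb := (@lebesgue_measure R).
Implicit Types (a b : Gc -> R) (p s t : R).

Lemma powR_expD q s (x : R) : 0 < s -> 0 <= x -> x ^+ q * x `^ s = x `^ (q%:R + s).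
Proof.
move=> s0 x0; rewrite -powR_mulrn// -powRD//.
by rewrite gt_eqF//; rewrite ltr_wpDl.
Qed.

(** If x <= de y, one factor [de] is gained from x^q and x + y <= 2y; otherwise y < x / de and
    everything is a power of [x]. *)
Lemma absorb q s (de x y : R) : (0 < q)%N -> 0 < s -> 0 < de <= 1 ->
  0 <= x -> 0 <= y ->
  x ^+ q * (x + y) `^ s <=
  de * 2 `^ s * y `^ (q%:R + s) + (1 + de^-1) `^ s * x `^ (q%:R + s).
Proof.
move=> q0 s0 /andP[de0 de1] x0 y0.
have [h|h] := leP x (de * y).
  apply: (@le_trans _ _ (de * 2 `^ s * y `^ (q%:R + s))); last first.
    by rewrite lerDl mulr_ge0 ?powR_ge0.
  rewrite -powR_expD// [leRHS](_ : _ = (de * y ^+ q) * (2 * y) `^ s); last first.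
    by rewrite powRM//; ring.
  apply: ler_pM; rewrite ?exprn_ge0 ?powR_ge0//.
    apply: (@le_trans _ _ ((de * y) ^+ q)).
      by rewrite lerXn2r// nnegrE mulr_ge0 ?(ltW de0).
    rewrite exprMn ler_wpM2r ?exprn_ge0// -(prednK q0) exprS.
    by rewrite ler_piMr ?(ltW de0)// exprn_ile1 ?(ltW de0).
  rewrite ge0_ler_powR ?(ltW s0)// ?nnegrE ?addr_ge0 ?mulr_ge0//.
  by nra.
apply: (@le_trans _ _ ((1 + de^-1) `^ s * x `^ (q%:R + s))); last first.
  by rewrite lerDr !mulr_ge0 ?powR_ge0// ltW.
have dei : 0 <= 1 + de^-1 by rewrite addr_ge0// invr_ge0 ltW.
rewrite -powR_expD// mulrCA ler_wpM2l ?exprn_ge0// -powRM//.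
rewrite ge0_ler_powR ?(ltW s0)// ?nnegrE ?addr_ge0 ?mulr_ge0//.
rewrite mulrDl mul1r lerD2l mulrC ler_pdivlMr// mulrC; exact: ltW.
Qed.

Lemma absorb_tav q s (c0 m C1 : R) : (0 < q)%N -> 0 < s -> 0 < c0 <= 1 ->
  1 <= m -> 0 <= C1 ->
  exists2 C, 0 <= C & forall N a b, (forall x, 0 <= a x) -> (forall x, 0 <= b x) ->
    c0 * tav N (fun x => b x `^ (q%:R + s)) <=
      C1 * tav N (fun x => a x `^ (q%:R + s)) +
      m * tav N (fun x => a x ^+ q * (a x + b x) `^ s) ->
    tav N (fun x => b x `^ (q%:R + s)) <= C * tav N (fun x => a x `^ (q%:R + s)).
Proof.
move=> q0 s0 /andP[c00 c01] m1 C10.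
have m0 : 0 < m by rewrite (lt_le_trans _ m1).
have ts1 : 1 <= 2 `^ s :> R.
  have t1 : 1 <= 2 :> R by rewrite ler1n.
  by have := ler_powR t1 (ltW s0); rewrite powRr0.
have ts0 : 0 < 2 `^ s :> R by rewrite (lt_le_trans _ ts1).
(* Chosen so that [m] times the [b]-term of [absorb] is exactly half of the left-hand side, which is
   then subtracted. *)
pose de := c0 / (2 * m * 2 `^ s).
have de0 : 0 < de by rewrite divr_gt0// !mulr_gt0.
have de1 : de <= 1.
  rewrite ler_pdivrMr ?mulr_gt0// mul1r (le_trans c01)//.
  by nra.
exists (2 / c0 * (C1 + m * (1 + de^-1) `^ s)).
  by rewrite mulr_ge0 ?divr_ge0 ?addr_ge0 ?mulr_ge0 ?powR_ge0 ?(ltW c00) ?(ltW m0).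
move=> N a b a0 b0 H.
set A := tav N (fun x => a x `^ _); set B := tav N (fun x => b x `^ _).
have H2 : tav N (fun x => a x ^+ q * (a x + b x) `^ s) <=
    de * 2 `^ s * B + (1 + de^-1) `^ s * A.
  rewrite -!tavZ -tavD; apply: ler_tav => x; apply: absorb => //.
  by rewrite de0.
have {}H := le_trans H (lerD (lexx _) (ler_wpM2l (ltW m0) H2)).
have deE : m * (de * 2 `^ s * B) = c0 / 2 * B.
  by rewrite /de; field; rewrite !gt_eqF.
rewrite mulrDr deE in H.
have {}H : c0 / 2 * B <= (C1 + m * (1 + de^-1) `^ s) * A.
  by move: H; rewrite -/B -/A => H; lra.
rewrite -(@ler_pM2l _ (c0 / 2)) ?divr_gt0//; apply: (le_trans H).
by rewrite !mulrA (_ : c0 / 2 * 2 / c0 = 1) ?mul1r//; field; rewrite gt_eqF.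
Qed.

Section levels_gt2.
Variables (s : R) (N : nat) (a b : Gc -> R) (K : R).
Hypotheses (s0 : 0 < s) (a0 : forall x, 0 <= a x) (b0 : forall x, 0 <= b x).
Hypothesis abK : forall x, (a x + b x) `^ s <= K.
Hypothesis H : forall t, 0 <= t ->
  tav N (fun x => b x ^+ 2 / 4 * (2 * t < b x)%R%:R) <=
  tav N (fun x => a x ^+ 2 * (t < a x + b x)%R%:R).

(** The level inequality is taken at t = u^(1/s) and integrated in [u], so that each indicator {t <
    r} contributes r^s. On the left this yields (b^2 / 4) (b / 2)^s, hence the constant. *)
Lemma lp_levels_gt2 : 2 `^ (- (2 + s)) * tav N (fun x => b x `^ (2 + s)) <=
  tav N (fun x => a x ^+ 2 * (a x + b x) `^ s).
Proof.
pose Phi u x := b x ^+ 2 / 4 * (u < (b x / 2) `^ s)%R%:R.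
pose Psi u x := a x ^+ 2 * (u < (a x + b x) `^ s)%R%:R.
have iZ (c r : R) : leb.-integrable `[0, K] (EFin \o (fun u => c * (u < r)%R%:R)).
  apply: (bounded_integrable_itv _ _ `|c|).
    by apply: measurable_funM => //; exact: measurable_ltr.
  by move=> u _; rewrite normrM; case: (u < r); rewrite ?normr1 ?normr0 ?mulr1 ?mulr0.
have bK x : (b x / 2) `^ s <= K.
  apply: le_trans (abK x); rewrite ge0_ler_powR ?(ltW s0)// ?nnegrE.
  - by rewrite divr_ge0.
  - by rewrite addr_ge0.
  - by have := a0 x; have := b0 x; lra.
have : tav N (fun x => \int[leb]_(u in `[0, K]) Phi u x) <=
       tav N (fun x => \int[leb]_(u in `[0, K]) Psi u x).
  apply: ler_tav_Rintegral => //; [by move=> x; exact: iZ..|].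
  move=> u /=; rewrite in_itv/= => /andP[u0 _].
  have -> : tav N (Phi u) =
      tav N (fun x => b x ^+ 2 / 4 * (2 * u `^ s^-1 < b x)%R%:R).
    apply: eq_tav => x; congr (_ * (nat_of_bool _)%:R).
    by rewrite -powR_lt_iff ?divr_ge0// ltr_pdivlMr// mulrC.
  have -> : tav N (Psi u) = tav N (fun x => a x ^+ 2 * (u `^ s^-1 < a x + b x)%R%:R).
    apply: eq_tav => x; congr (_ * (nat_of_bool _)%:R).
    by rewrite -powR_lt_iff ?addr_ge0.
  exact/H/powR_ge0.
rewrite /Phi /Psi.
under eq_tav => x do rewrite RintegralZl ?integrable_ltr// Rintegral_ltr ?powR_ge0 ?bK//.
under [X in _ <= X]eq_tav => x do
  rewrite RintegralZl ?integrable_ltr// Rintegral_ltr ?powR_ge0 ?abK//.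
apply: le_trans; rewrite -tavZ; apply: ler_tav => x.
rewrite powRN powRD ?powR_mulrn//; last by rewrite gt_eqF// addr_gt0.
have half_powR : 2^-1 `^ s = (2 `^ s)^-1 :> R.
  by rewrite -[2^-1]powR_inv1// -powRrM mulN1r powRN.
rewrite -(@powR_expD 2)// powRM ?invr_ge0// half_powR.
rewrite le_eqVlt; apply/orP; left; apply/eqP; field.
by rewrite gt_eqF// powR_gt0.
Qed.

End levels_gt2.

End lp_from_levels.

Section lp_from_levels_lt2.
Context {R : realType}.
Notation leb := (@lebesgue_measure R).
Variables (s : R) (N : nat) (a b : Gc -> R) (K : R).
Hypotheses (s0 : 0 < s) (s1 : s < 1).
Hypotheses (a0 : forall x, 0 <= a x) (b0 : forall x, 0 <= b x).
Hypothesis abK : forall x, (a x + b x) `^ s < K.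
Hypothesis H : forall t, 0 <= t ->
  tav N (fun x => t ^+ 2 * (t < b x)%R%:R) <=
  tav N (fun x => a x ^+ 2 * (a x + b x <= t)%R%:R +
                  2 * t * a x * (t < a x + b x)%R%:R).

Lemma ler_powRN (e u v : R) : 0 < u -> u <= v -> 0 <= e -> v `^ (- e) <= u `^ (- e).
Proof.
move=> u0 uv e0; have v0 : 0 < v by exact: lt_le_trans uv.
by rewrite !powRN lef_pV2 ?posrE ?powR_gt0// ge0_ler_powR// nnegrE ltW.
Qed.

(** With v = t^s this is 1 / t restricted to {v >= r}. *)
Let tailpow (r v : R) : R := (1 - (v < r)%R%:R) * v `^ (- s^-1).

Lemma integrable_tailpow r : 0 < r -> leb.-integrable `[0, K] (EFin \o tailpow r).
Proof.
move=> r0; apply: (bounded_integrable_itv _ _ (r `^ (- s^-1))).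
  apply: measurable_funM; last exact: measurable_powR.
  by apply: measurable_funB => //; exact: measurable_ltr.
move=> v _; rewrite /tailpow; case: ltP => vr.
  by rewrite subrr mul0r normr0 powR_ge0.
rewrite subr0 mul1r ger0_norm ?powR_ge0//; apply: ler_powRN => //.
by rewrite invr_ge0 ltW.
Qed.

Lemma Rintegral_tailpow r : 0 < r -> r < K ->
  \int[leb]_(v in `[0, K]) tailpow r v <= r `^ (1 - s^-1) / (s^-1 - 1).
Proof.
move=> r0 rK; have is1 : 1 < s^-1 by rewrite invf_gt1.
apply: le_trans (Rintegral_powR_le K r s^-1 r0 rK is1).
have -> : (`[r, K] = `[0, K] `&` `[r, +oo[ :> set R)%classic.
  apply/seteqP; split => v /=; rewrite !in_itv/= andbT.
    by move=> /andP[rv ->]; rewrite (le_trans (ltW r0) rv).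
  by move=> [/andP[_ ->] ->].
rewrite Rintegral_mkcondr le_eqVlt; apply/orP; left; apply/eqP.
apply: eq_Rintegral => v _; rewrite /tailpow patchE mem_setE in_itv/= andbT.
by case: ltP => vr; rewrite ?subrr ?mul0r// subr0 mul1r.
Qed.

(** The level inequality is divided by [t] and integrated in v = t^s. The term a^2 / t on {a + b <=
    t} gives a^2 (a + b)^(s-1) s / (1 - s), at most a^(1+s) s / (1 - s); the other one gives 2a (a +
    b)^s. *)
Lemma lp_levels_lt2 : 2^-1 `^ s^-1 / 2 * tav N (fun x => b x `^ (1 + s)) <=
  s / (1 - s) * tav N (fun x => a x `^ (1 + s)) +
  2 * tav N (fun x => a x ^+ 1 * (a x + b x) `^ s).
Proof.
have is0 : 0 < s^-1 by rewrite invr_gt0.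
pose c := 2^-1 `^ s^-1 : R.
(* A step function below t on {t < b}: on the upper half of the range of [v] one has t >= b
   (1/2)^(1/s). It loses only a constant and its integral is immediate. *)
pose Phi v x := b x * c * ((v < b x `^ s)%R%:R - (v < b x `^ s / 2)%R%:R).
(* Where a = 0 the sum a + b may vanish as well, and v^(-1/s) is not integrable near 0; the term is
   set to zero there. *)
pose Psi1 v x := if a x == 0 then 0 else a x ^+ 2 * tailpow ((a x + b x) `^ s) v.
pose Psi2 v x := 2 * a x * (v < (a x + b x) `^ s)%R%:R.
have c0 : 0 <= c by exact: powR_ge0.
have iD (r r' : R) :
    leb.-integrable `[0, K] (EFin \o (fun u => (u < r)%R%:R - (u < r')%R%:R)).
  apply: (bounded_integrable_itv _ _ 1).
    by apply: measurable_funB; exact: measurable_ltr.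
  by move=> u _; case: (u < r); case: (u < r');
    rewrite ?subrr ?subr0 ?sub0r ?normrN ?normr0 ?normr1.
have iZ (k r : R) : leb.-integrable `[0, K] (EFin \o (fun u => k * (u < r)%R%:R)).
  by apply: (integrableZl _ k (integrable_ltr K r)).
have ab0 x : a x != 0 -> 0 < (a x + b x) `^ s.
  by move=> ax; rewrite powR_gt0// ltr_wpDr// lt_def ax a0.
have iPhi x : leb.-integrable `[0, K] (EFin \o (Phi ^~ x)).
  exact: (integrableZl _ _ (iD _ _)).
have iPsi1 x : leb.-integrable `[0, K] (EFin \o (Psi1 ^~ x)).
  rewrite /Psi1; case: eqP => [_|/eqP ax]; first exact: integrable0.
  by apply: (integrableZl _ _ (integrable_tailpow _ _)) => //; exact: ab0.
have iPsi2 x : leb.-integrable `[0, K] (EFin \o (Psi2 ^~ x)) by exact: iZ.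
have iPsi x : leb.-integrable `[0, K] (EFin \o (fun v => Psi1 v x + Psi2 v x)).
  exact: (integrableD _ (iPsi1 x) (iPsi2 x)).
have : tav N (fun x => \int[leb]_(u in `[0, K]) Phi u x) <=
       tav N (fun x => \int[leb]_(u in `[0, K]) (Psi1 u x + Psi2 u x)).
  apply: (ler_tav_Rintegral _ _ _ leb _ (measurable_itv _)) => // v /=.
  rewrite in_itv/= => /andP[v0 _]; set t := v `^ s^-1.
  have t0 : 0 <= t by exact: powR_ge0.
  have PhiP x : Phi v x <= t * (t < b x)%R%:R.
    rewrite powR_lt_iff// /Phi.
    have [vb|vb] := ltP v (b x `^ s); last first.
      by rewrite [v < _ / 2]ltNge (le_trans _ vb) ?subrr ?mulr0//
        ler_pdivrMr// ler_peMr ?powR_ge0// ler1n.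
    have [vb2|vb2] := ltP v (b x `^ s / 2); first by rewrite subrr mulr0 mulr1.
    rewrite subr0 !mulr1.
    have -> : b x * c = (b x `^ s / 2) `^ s^-1.
      by rewrite powRM ?powR_ge0// -powRrM divff ?gt_eqF// powRr1.
    by rewrite ge0_ler_powR ?(ltW is0)// nnegrE ?divr_ge0 ?powR_ge0.
  (* Level 0 cannot be divided by [t], but there [Phi] is at most 0 and the right-hand side is
     nonnegative. *)
  have [t00|tN0] := eqVneq t 0.
    apply: ler_tav => x; apply: le_trans (PhiP x) _; rewrite t00 mul0r.
    rewrite addr_ge0// ?mulr_ge0//; rewrite /Psi1; case: ifP => // _.
    rewrite mulr_ge0 ?sqr_ge0// mulr_ge0 ?powR_ge0//.
    by case: (_ < _); rewrite ?subrr ?subr0.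
  have tp : 0 < t by rewrite lt_def tN0.
  apply: (@le_trans _ _ (t^-1 * tav N (fun x => t ^+ 2 * (t < b x)%R%:R))).
    rewrite -tavZ; apply: ler_tav => x; apply: le_trans (PhiP x) _.
    by rewrite expr2 !mulrA mulVf// mul1r.
  apply: (le_trans (ler_wpM2l _ (H t t0))); first by rewrite invr_ge0.
  rewrite -tavZ; apply: ler_tav => x.
  rewrite mulrDr lerD//; last first.
    rewrite /Psi2 powR_lt_iff ?addr_ge0//.
    by rewrite !mulrA (mulrAC t^-1 2) mulVf// mul1r.
  rewrite /Psi1 /tailpow [a x + b x <= t]leNgt powR_lt_iff ?addr_ge0//.
  case: eqP => [->|_]; first by rewrite expr0n mul0r mulr0.
  rewrite powRN -/t; case: (v < _); rewrite /= ?subrr ?mulr0 ?mul0r ?mulr0//.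
  by rewrite subr0 mul1r mulr1 mulrC.
have E1 x : \int[leb]_(u in `[0, K]) Phi u x = c / 2 * b x `^ (1 + s).
  rewrite /Phi RintegralZl//.
  rewrite RintegralB//; [|exact: integrable_ltr..].
  have bK : b x `^ s <= K.
    apply: le_trans (ltW (abK x)); rewrite ge0_ler_powR ?(ltW s0)// ?nnegrE ?addr_ge0//.
    by rewrite lerDr.
  have b2 : b x `^ s / 2 <= b x `^ s by have := powR_ge0 (b x) s; lra.
  rewrite !Rintegral_ltr ?powR_ge0 ?divr_ge0 ?powR_ge0 ?(le_trans b2)//.
  by rewrite -(@powR_expD _ 1)// expr1; field.
have E2 x : \int[leb]_(u in `[0, K]) (Psi1 u x + Psi2 u x) <=
    s / (1 - s) * a x `^ (1 + s) + 2 * (a x ^+ 1 * (a x + b x) `^ s).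
  rewrite RintegralD// lerD//; last first.
    rewrite /Psi2 RintegralZl ?integrable_ltr// Rintegral_ltr; first by rewrite mulrA.
    by rewrite powR_ge0 ltW.
  rewrite /Psi1; case: eqP => [ax|/eqP ax].
    by rewrite Rintegral_cst// mul0r mulr_ge0 ?powR_ge0 ?divr_ge0 ?subr_ge0 ?(ltW s0) ?(ltW s1).
  have ap : 0 < a x by rewrite lt_def ax a0.
  rewrite RintegralZl//; last by apply: integrable_tailpow; exact: ab0.
  apply: (le_trans (ler_wpM2l (sqr_ge0 _) (Rintegral_tailpow _ (ab0 x ax) (abK x)))).
  rewrite -powRrM mulrBr mulr1 divff ?gt_eqF//.
  rewrite (_ : s - 1 = - (1 - s)); last by rewrite opprB.
  have s1' : 0 <= 1 - s by rewrite subr_ge0 ltW.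
  have := @ler_powRN (1 - s) (a x) (a x + b x) ap _ s1'.
  rewrite lerDl b0 => /(_ isT) le1.
  have -> : s / (1 - s) * a x `^ (1 + s) = a x ^+ 2 * (a x `^ (- (1 - s)) / (s^-1 - 1)).
    rewrite (_ : 1 + s = 2 - (1 - s)); last by lra.
    rewrite powRB; last by rewrite ax implybT.
    rewrite powR_mulrn// powRN; field.
    by rewrite mulN1r !gt_eqF ?powR_gt0 ?subr_gt0.
  rewrite ler_wpM2l ?sqr_ge0// ler_wpM2r// invr_ge0 subr_ge0.
  by rewrite ltW// invf_gt1.
rewrite (eq_tav _ _ _ E1) tavZ => /le_trans; apply.
by rewrite -!tavZ -tavD; apply: ler_tav.
Qed.

End lp_from_levels_lt2.

(** * L^p bounds for the partial sums *)

Section lp_bound.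
Context {R : realType}.

(** When |y| > 2t, the distance |y| - t exceeds |y| / 2; this explains both the 4 and the threshold
    2t. *)
Lemma burkoo_ge (t a y : R) : 0 <= t -> 0 <= a ->
  `|y| ^+ 2 / 4 * (2 * t < `|y|)%R%:R <=
  burkoo t a y + a ^+ 2 * (t < a + `|y|)%R%:R.
Proof.
move=> t0 a0; have y0 := normr_ge0 y; rewrite /burkoo.
have [h|h] := leP (a + `|y|) t.
  rewrite mulr0 addr0 [_ < _](_ : _ = false) ?mulr0//.
  by apply/negbTE; rewrite -leNgt; lra.
rewrite mulr1 subrK; have [h2|h2] := ltP (2 * t) `|y|; last by rewrite mulr0 sqr_ge0.
by rewrite mulr1; nra.
Qed.

Lemma burk1_ge_level (t a y : R) : 0 <= t -> 0 <= a ->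
  t ^+ 2 * (t < `|y|)%R%:R <= burk1 t a y +
    (a ^+ 2 * (a + `|y| <= t)%R%:R + 2 * t * a * (t < a + `|y|)%R%:R).
Proof.
move=> t0 a0; have y0 := normr_ge0 y; rewrite /burk1.
have [h|h] := leP (a + `|y|) t.
  rewrite mulr0 addr0 mulr1 subrK [_ < _](_ : _ = false) ?mulr0 ?sqr_ge0//.
  by apply/negbTE; rewrite -leNgt; lra.
rewrite mulr0 add0r mulr1 subrK; case: (_ < _); rewrite ?mulr1// mulr0.
exact: sqr_ge0.
Qed.

(* The exponents below and above 2 are reached by integrating over [t] the
   level inequalities coming from [burk1] and [burkoo] respectively. *)
Lemma lp_from_levels p : 1 < p -> exists2 C : R, 0 <= C &
  forall N (a b : Gc -> R), (forall x, 0 <= a x) -> (forall x, 0 <= b x) ->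
    depends_on N a -> depends_on N b ->
    (forall t, 0 <= t -> tav N (fun x => b x ^+ 2 / 4 * (2 * t < b x)%R%:R) <=
       tav N (fun x => a x ^+ 2 * (t < a x + b x)%R%:R)) ->
    (forall t, 0 <= t -> tav N (fun x => t ^+ 2 * (t < b x)%R%:R) <=
       tav N (fun x => a x ^+ 2 * (a x + b x <= t)%R%:R +
                       2 * t * a x * (t < a x + b x)%R%:R)) ->
    tav N (fun x => b x `^ p) <= C * tav N (fun x => a x `^ p).
Proof.
move=> p1.
have bd s N (a b : Gc -> R) : depends_on N a -> depends_on N b ->
    exists K : R, forall x, (a x + b x) `^ s < K.
  move=> da db; have [|M _ h] := depends_on_bounded _ N (fun x => (a x + b x) `^ s).
    by move=> x y xy; rewrite (da _ y)// (db _ y).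
  by exists (M + 1) => x; rewrite (le_lt_trans (ler_norm _))// (le_lt_trans (h x))// ltrDl.
have [p2|p2|->] := ltgtP p 2.
- have s0 : 0 < p - 1 by rewrite subr_gt0.
  have s1 : p - 1 < 1 by rewrite ltrBlDr.
  have pE : p = 1%:R + (p - 1) by lra.
  have [|||C C0 HC] := @absorb_tav R 1 (p - 1) (2^-1 `^ (p - 1)^-1 / 2) 2
    ((p - 1) / (1 - (p - 1))) isT s0.
  + rewrite divr_gt0 ?powR_gt0//= ler_pdivrMr// mul1r.
    have h01 : 0 < (2^-1 : R) <= 1 by rewrite invr_gt0 ltr0n invf_le1// ler1n.
    have := ger_powR h01 (_ : 0 <= (p - 1)^-1); rewrite powRr0 => h.
    by apply: (le_trans (h _)); rewrite ?invr_ge0 ?(ltW s0)// ler1n.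
  + by rewrite ler1n.
  + by rewrite divr_ge0 ?subr_ge0 ?(ltW s1)// ltW.
  exists C => // N a b a0 b0 da db _ H; rewrite pE; apply: HC => //.
  have [K abK] := bd (p - 1) N a b da db.
  exact: (lp_levels_lt2 (p - 1) N a b K).
- have s0 : 0 < p - 2 by rewrite subr_gt0.
  have pE : p = 2%:R + (p - 2) by lra.
  have [|||C C0 HC] := @absorb_tav R 2 (p - 2) (2 `^ (- (2 + (p - 2)))) 1 0 isT s0.
  + rewrite powR_gt0//= -pE powRN invf_le1 ?powR_gt0//.
    have t1 : 1 <= 2 :> R by rewrite ler1n.
    by have := ler_powR t1 (ltW (lt_trans ltr01 p1)); rewrite powRr0.
  + by [].
  + by [].
  exists C => // N a b a0 b0 da db H _; rewrite pE; apply: HC => //.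
  rewrite mul0r add0r mul1r.
  have [K abK] := bd (p - 2) N a b da db.
  by apply: (lp_levels_gt2 (p - 2) N a b K) => // x; exact: ltW.
- exists 4 => // N a b a0 b0 _ _ H _.
  have := H 0 (lexx 0).
  rewrite (eq_tav _ _ (fun x => 4^-1 * b x `^ 2)); last first.
    move=> x; rewrite mulr0 powR_mulrn// mulrC; case: ltP => bx.
      by rewrite mulr1n mul1r mulrC.
    by rewrite (_ : b x = 0) ?expr0n/= ?mulr0 ?mul0r//; apply/le_anti; rewrite bx b0.
  rewrite tavZ => h.
  have {}h : 4^-1 * tav N (fun x => b x `^ 2) <= tav N (fun x => a x `^ 2).
    apply: (le_trans h); apply: ler_tav => x; rewrite powR_mulrn//.
    by case: (_ < _); rewrite ?mulr1// mulr0 sqr_ge0.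
  by move: h; lra.
Qed.

Variable mu : {measure set G -> \bar R}.
Hypothesis haar_mu : haar mu.

(** At the root |S| <= |E_0 f|, so both special functions start at or below 0 and their averages
    stay there; this supplies the level inequalities for a = |E_N f| and b = |S|. Jensen's
    inequality then replaces |E_N f| by |f|. *)
Lemma psum_lp p : 1 < p -> exists2 C : R, 0 <= C &
  forall N (f : nat -> G -> R),
    (forall i, mu.-integrable [set: G] (EFin \o f i)) ->
    mu.-integrable [set: G] (EFin \o (fun x => vnorm N.+1 (f ^~ x) `^ p)) ->
    \int[mu]_x (`|psum mu f N.+1 x| `^ p) <=
    C * \int[mu]_x (vnorm N.+1 (f ^~ x) `^ p).
Proof.
move=> p1; have [C C0 HC] := lp_from_levels p p1; exists C => // N f fi ifp.
pose a := mnorm mu f N.+1 N; pose b x := `|psum mu f N.+1 x|.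
have a0 x : 0 <= a x by exact: vnorm_ge0.
have db : depends_on N b.
  by move=> x y xy; rewrite /b (depends_on_psum mu f N x y).
have da : depends_on N a by exact: depends_on_mnorm.
rewrite (Rintegral_tav _ haar_mu N); last by move=> x y xy; rewrite -!/(b _) (db x y).
apply: (@le_trans _ _ (C * tav N (fun x => a x `^ p))); last first.
  rewrite ler_wpM2l// -(tav_condE mu N)//; apply: ler_tav => x.
  have iF : mu.-integrable [set: G] (EFin \o (fun y => vnorm N.+1 (f ^~ y))).
    exact: intg_vnorm.
  have := condE_jensen _ haar_mu N p (fun y => vnorm N.+1 (f ^~ y)) x p1 _ iF ifp.
  move=> /(_ (fun y => vnorm_ge0 _ _)); apply: le_trans.
  rewrite ge0_ler_powR ?nnegrE//; first by rewrite ltW// (lt_trans _ p1).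
    by apply: condE_ge0 => y; exact: vnorm_ge0.
  exact: vnorm_condE.
apply: HC => // t t0.
- have sU : supermartingale N (fun n x => burkoo t (mnorm mu f N.+1 n x) (psum mu f n.+1 x)).
    move=> n x nN; apply: midpoint_step => //.
    by move=> a' a1 a2 eta be y k; exact: burkoo_midpoint.
  have := tav_supermartingale _ _ sU.
  have := burkoo_le0 t _ _ t0 (psum0_le mu f N.+1 zeroG isT) => h1 h2.
  have h3 := le_trans h2 h1.
  apply: (@le_trans _ _ (tav N (fun x => burkoo t (a x) (psum mu f N.+1 x) +
      a x ^+ 2 * (t < a x + b x)%R%:R))).
    by apply: ler_tav => x; exact: burkoo_ge.
  by rewrite tavD gerDr.
- have sU : supermartingale N (fun n x => burk1 t (mnorm mu f N.+1 n x) (psum mu f n.+1 x)).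
    move=> n x nN; apply: midpoint_step => //.
    by move=> a' a1 a2 eta be y k; exact: burk1_midpoint.
  have := tav_supermartingale _ _ sU.
  have := burk1_le0 t _ _ t0 (psum0_le mu f N.+1 zeroG isT) => h1 h2.
  have h3 := le_trans h2 h1.
  apply: (@le_trans _ _ (tav N (fun x => burk1 t (a x) (psum mu f N.+1 x) +
      (a x ^+ 2 * (a x + b x <= t)%R%:R + 2 * t * a x * (t < a x + b x)%R%:R)))).
    by apply: ler_tav => x; exact: burk1_ge_level.
  by rewrite tavD gerDr.
Qed.

End lp_bound.

(** * Invariance of Haar measure *)

Section translations.
Context {R : realType} (mu : {measure set G -> \bar R}).
Hypothesis haar_mu : haar mu.

Lemma gsubK (x : Gc) : involutive (gsub x).
Proof.
by move=> y; apply/funext => i; rewrite /gsub; case: (x i); case: (y i).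
Qed.

Lemma gsub_cyl n (x a : Gc) : gsub x @^-1` cyl n a = cyl n (gsub x a).
Proof.
apply/seteqP; split => y /= h i iN; have := h i iN; rewrite /gsub;
  by case: (x i); case: (a i); case: (y i).
Qed.

Lemma measurable_gsub (x : G) : measurable_fun [set: G] (gsub x : G -> G).
Proof.
apply: (@measurability _ _ G G setT (gsub x) (cylinders : set (set G))) => //.
move=> _ [_ [n [a ->]] <-]; rewrite setTI gsub_cyl.
exact: cylinder_measurable.
Qed.

(** Two cylinders are nested or disjoint; the empty set is adjoined for the second case. *)
Lemma setI_closed_cylinders : setI_closed (cylinders `|` [set set0]).
Proof.
have key n a m b : (n <= m)%N ->
    cyl n a `&` cyl m b = cyl m b \/ cyl n a `&` cyl m b = set0.
  move=> nm; have [h|h] := pselect (forall i, (i < n)%N -> a i = b i); [left|right].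
    apply/setIidPr => y yb i iN; rewrite h// yb//; exact: leq_trans nm.
  apply/seteqP; split => // y [ya yb]; apply: h => i iN.
  by rewrite -ya// yb//; exact: leq_trans nm.
move=> A B [[n [a ->]]|->] [[m [b ->]]|->]; rewrite ?set0I ?setI0; [|by right..].
have [nm|/ltnW mn] := leqP n m.
  by case: (key n a m b nm) => ->; [left; exists m, b|right].
by rewrite setIC; case: (key m b n a mn) => ->; [left; exists n, a|right].
Qed.

(** Both measures give mass 2^-n to every cylinder of length [n], and cylinders together with the
    empty set form a generating family stable under intersection. *)
Lemma haar_gsub (x : G) (A : set G) : measurable A ->
  mu (gsub x @^-1` A) = mu A.
Proof.
pose phi : {mfun G >-> G} := HB.pack (gsub x : G -> G)
  (isMeasurableFun.Build _ _ _ _ (gsub x : G -> G) (measurable_gsub x)).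
apply: (@measure_unique _ R G (cylinders `|` [set set0]) (fun=> setT) _ _ _ _
  (pushforward mu phi) mu).
- apply/seteqP; split; first by apply: sub_sigma_algebra2 => B; left.
  apply: smallest_sub; first exact: smallest_sigma_algebra.
  by move=> B [CB|->]; [exact: sub_sigma_algebra|exact: measurable0].
- exact: setI_closed_cylinders.
- by move=> _; left; exists 0%N, zeroG; rewrite cyl0.
- by rewrite bigcup_const.
- move=> B [[n [a ->]]|->]; last by rewrite !measure0.
  transitivity (mu (cyl n (gsub x a))); first by congr (mu _); exact: gsub_cyl.
  by rewrite ![mu _]haar_mu.
- move=> _; have : (mu (gsub x @^-1` setT) < +oo)%E; last exact.
  by rewrite preimage_setT haarT// ltry.
Qed.

Lemma integral_gsub (x : G) (D : set G) (h : G -> R) : measurable D ->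
  mu.-integrable [set: G] (EFin \o h) ->
  (\int[mu]_(y in gsub x @^-1` D) (h (gsub x y))%:E = \int[mu]_(z in D) (h z)%:E)%E.
Proof.
move=> mD ih.
pose phi : {mfun G >-> G} := HB.pack (gsub x : G -> G)
  (isMeasurableFun.Build _ _ _ _ (gsub x : G -> G) (measurable_gsub x)).
have mh : measurable_fun [set: G] (EFin \o h) by exact: measurable_int ih.
have inv E (k : G -> \bar R) :
    (\int[pushforward mu phi]_(y in E) k y = \int[mu]_(y in E) k y)%E.
  by apply: eq_measure_integral => B mB _; exact: haar_gsub.
have ihx : mu.-integrable (gsub x @^-1` D) ((EFin \o h) \o gsub x).
  apply: (@integrableS _ _ _ _ setT) => //.
    by rewrite -[_ @^-1` _]setTI; exact: measurable_gsub.
  apply/integrableP; split; first exact: measurableT_comp mh (measurable_gsub x).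
  have /integrableP[_] := ih.
  rewrite -inv (ge0_integral_pushforward (measurable_gsub x))//.
  by apply: measurableT_comp => //; exact: measurable_abse.
rewrite -[RHS]inv; apply/esym.
exact: (integral_pushforward (measurable_gsub x) mh ihx mD).
Qed.

End translations.

Local Arguments kappa {R} n x : simpl never.

(** * The kernel and its truncated integrals *)

Section principal_value.
Context {R : realType} (mu : {measure set G -> \bar R}).
Hypothesis haar_mu : haar mu.

(** The two terms are the integral kernels of E_(n+1) and E_n, so integration against [kappa]
    produces [Delta]. *)
Lemma kappaE n (x z : Gc) : kappa n.+1 (gsub x z) =
  2 ^+ n.+1 * \1_(cyl n.+1 x) z - 2 ^+ n * \1_(cyl n x) z :> R.
Proof.
have gF i : (gsub x z i = false) <-> (z i = x i).
  by rewrite /gsub; case: (x i); case: (z i).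
rewrite /kappa; case: asboolP => [h|h].
  have hz m : (m <= n.+1)%N -> cyl m x z.
    by move=> mn i im; apply/gF/h; rewrite -ltnS; exact: leq_trans mn.
  by rewrite !indicE !mem_set ?mulr1 ?exprS; [ring|exact: hz..].
have h1 : ~ cyl n.+1 x z by move=> zx; apply: h => i iN; apply/gF/zx.
rewrite [\1_(cyl n.+1 x) z]indicE (memNset h1) mulr0 sub0r.
case: asboolP => [[h2 _]|h2].
  by rewrite indicE mem_set ?mulr1// => i iN; apply/gF/h2.
rewrite indicE memNset ?mulr0 ?oppr0// => zx; apply: h2; split.
  by move=> i iN; apply/gF/zx.
apply/negPn/negP => /negbTE gn; apply: h1 => i; rewrite ltnS leq_eqVlt.
by move=> /predU1P[->|iN]; [apply/gF|exact: zx].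
Qed.

Lemma depends_on_kappa n (x : Gc) : depends_on n (fun z => kappa n (gsub x z) : R).
Proof.
case: n => [//|n] z z' zz; rewrite !kappaE.
have e m : (m <= n.+1)%N -> \1_(cyl m x) z = \1_(cyl m x) z' :> R.
  move=> mn; rewrite !indicE; congr (nat_of_bool _)%:R.
  apply/idP/idP; rewrite !inE => h i im;
    by have := h i im; rewrite zz//; exact: leq_trans mn.
by rewrite !e.
Qed.

Lemma integrable_kappaM n (x : Gc) (h : G -> R) :
  mu.-integrable [set: G] (EFin \o h) ->
  mu.-integrable [set: G] (EFin \o (fun z => kappa n (gsub x z) * h z)).
Proof.
move=> ih; have [M M0 kM] := depends_on_bounded _ _ _ (depends_on_kappa n x).
apply: (intg_le mu _ (fun z => M * `|h z|)).
- apply: measurable_funM; last exact: intg_measurable ih.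
  exact: depends_on_measurable (depends_on_kappa n x).
- by move=> z; rewrite normrM ler_wpM2r.
- by apply: intgZ; exact: intg_norm.
Qed.

Lemma Rintegral_indicM (A : set G) (h : G -> R) :
  \int[mu]_z (\1_A z * h z) = \int[mu]_(z in A) h z.
Proof.
rewrite [RHS]Rintegral_mkcond; apply: eq_Rintegral => z _.
rewrite patchE indicE; case: (z \in A); by rewrite ?mul1r ?mul0r.
Qed.

Lemma integrable_indicM (A : set G) (h : G -> R) : measurable A ->
  mu.-integrable [set: G] (EFin \o h) ->
  mu.-integrable [set: G] (EFin \o (fun z => \1_A z * h z)).
Proof.
move=> mA ih; apply: (intg_le mu _ (fun z => `|h z|)); last exact: intg_norm.
  by apply: measurable_funM; [exact: measurable_indic|exact: intg_measurable ih].
by move=> z; rewrite normrM indicE; case: (_ \in _); rewrite ?normr1 ?normr0 ?mul1r ?mul0r.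
Qed.

Lemma Rintegral_kappaM n (x : Gc) (h : G -> R) :
  mu.-integrable [set: G] (EFin \o h) ->
  \int[mu]_z (kappa n (gsub x z) * h z) = Delta mu n h x.
Proof.
move=> ih; case: n => [|n].
  by rewrite /= condE0; apply: eq_Rintegral => z _; rewrite mul1r.
have i1 m := integrable_indicM _ _ (cylinder_measurable m x) ih.
transitivity (\int[mu]_z (2 ^+ n.+1 * (\1_(cyl n.+1 x) z * h z) -
    2 ^+ n * (\1_(cyl n x) z * h z))).
  by apply: eq_Rintegral => z _; rewrite kappaE mulrBl !mulrA.
rewrite RintegralB//; [|exact: intgZ..].
by rewrite !RintegralZl// !Rintegral_indicM.
Qed.

(** The constant value of [kappa n] on the cylinder of length [n] around the identity. *)
Definition kcoef (n : nat) : R := if n is m.+1 then 2 ^+ m else 1.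

Lemma Rintegral_kappaM_cyl n N (x : Gc) (h : G -> R) : (n <= N)%N ->
  mu.-integrable [set: G] (EFin \o h) ->
  \int[mu]_(z in cyl N x) (kappa n (gsub x z) * h z) =
  kcoef n * \int[mu]_(z in cyl N x) h z.
Proof.
move=> nN ih; rewrite -RintegralZl; last 2 first.
- exact: cylinder_measurable.
- exact: integrable_cyl.
apply: eq_Rintegral => z; rewrite inE => zx; congr (_ * _).
case: n nN => [//|n] nN.
have hz m : (m <= n.+1)%N -> cyl m x z.
  by move=> mn i im; apply: zx; rewrite (leq_trans im)// (leq_trans mn).
by rewrite kappaE !indicE !mem_set ?mulr1 ?exprS /kcoef; [ring|exact: hz..].
Qed.

Variable f : nat -> G -> R.
Hypothesis fi : forall i, mu.-integrable [set: G] (EFin \o f i).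

(** A nonzero coordinate among the first [N] kills every [kappa n] with n > N, so the limit defining
    [kpair] is that of an eventually constant sequence. *)
Lemma kpairE N x y : ~ cyl N zeroG y ->
  kpair f x y = \sum_(n < N.+1) kappa n y * f n (gsub x y).
Proof.
move=> yN.
have kappa0 k : kappa (N + k).+1 y = 0 :> R.
  rewrite /kappa; case: asboolP => [h|_].
    by exfalso; apply: yN => i iN; rewrite h// (leq_trans (ltnW iN))// leq_addr.
  case: asboolP => [[h _]|//].
  by exfalso; apply: yN => i iN; rewrite h// (leq_trans iN)// leq_addr.
apply: norm_lim_near_cst; exists N.+1 => // M /= NM.
rewrite -(subnKC NM); elim: (M - N.+1)%N => [|k IH]; first by rewrite addn0.
by rewrite addnS big_ord_recr /= IH addSn kappa0 mul0r addr0.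
Qed.

(** The part of the full integral carried by the removed cylinder, where the kernel equals [kcoef];
    the factor 2^-N undoes the normalization of [condE]. *)
Definition pverr N (x : G) : R :=
  2^-1 ^+ N * \sum_(n < N.+1) kcoef n * condE mu N (f n) x.

Lemma integral_kpair N (x : G) :
  (\int[mu]_(y in ~` cyl N zeroG) (kpair f x y)%:E =
   (psum mu f N.+1 x - pverr N x)%:E)%E.
Proof.
pose w z := \sum_(n < N.+1) kappa n (gsub x z) * f n z.
have iw : mu.-integrable [set: G] (EFin \o w).
  under [X in integrable _ _ X]eq_fun do rewrite /= /w -sumEFin.
  by apply: integrable_sum => // n _; exact: integrable_kappaM.
have gx : gsub x @^-1` (~` cyl N x) = ~` cyl N zeroG.
  rewrite -preimage_setC gsub_cyl; congr (~` cyl N _).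
  by apply/funext => i; rewrite /gsub /zeroG; case: (x i).
transitivity (\int[mu]_(y in gsub x @^-1` (~` cyl N x)) (w (gsub x y))%:E)%E.
  rewrite gx; apply: eq_integral => y; rewrite inE => yN.
  by rewrite (kpairE N)// /w gsubK.
have mC : measurable (cyl N x : set G) by exact: cylinder_measurable.
rewrite integral_gsub//; last exact: measurableC.
have iwC : mu.-integrable (~` cyl N x) (EFin \o w).
  by apply: integrableS iw => //; exact: measurableC.
rewrite -[LHS]fineK; last by apply: integrable_fin_num => //; exact: measurableC.
congr (_%:E); rewrite -/(Rintegral mu (~` cyl N x) w).
have : \int[mu]_z w z = \int[mu]_(z in cyl N x) w z + \int[mu]_(z in ~` cyl N x) w z.
  rewrite -Rintegral_setU ?setUv//; first exact: measurableC.
  by apply/disj_setPS; rewrite setICr.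
move=> /eqP; rewrite addrC -subr_eq => /eqP <-.
have sumR (D : set G) : measurable D -> \int[mu]_(z in D) w z =
    \sum_(n < N.+1) \int[mu]_(z in D) (kappa n (gsub x z) * f n z).
  move=> mD; rewrite /Rintegral /w.
  under eq_integral do rewrite -sumEFin.
  rewrite integral_sum//; last first.
    by move=> n; apply: integrableS (integrable_kappaM n x _ (fi n)).
  rewrite sum_fine// => n _; apply: integrable_fin_num => //.
  by apply: integrableS (integrable_kappaM n x _ (fi n)).
rewrite !sumR//; congr (_ - _).
  by apply: eq_bigr => n _; exact: Rintegral_kappaM.
rewrite /pverr mulr_sumr; apply: eq_bigr => n _.
rewrite Rintegral_kappaM_cyl//; last by rewrite -ltnS.
rewrite mulrCA; congr (_ * _); rewrite /condE mulrA -exprMn mulVf// expr1n mul1r.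
by [].
Qed.

(** A first difference at index [m], counted from 0, means distance 2^-(m+1), so being at distance
    at least [r] says exactly m < N. Truncation thus depends only on the dyadic scale of [r]. *)
Lemma dist_ball N (r : R) : 2^-1 ^+ N.+1 < r <= 2^-1 ^+ N ->
  [set y : G | r <= dist y zeroG] = ~` cyl N zeroG.
Proof.
move=> /andP[r1 r2].
have r0 : 0 < r by apply: le_lt_trans r1; rewrite exprn_ge0.
have le2 m n : (m <= n)%N -> 2^-1 ^+ n <= 2^-1 ^+ m :> R.
  by move=> mn; apply: ler_wiXn2l => //; rewrite invf_le1// ler1n.
apply/seteqP; split => y /=; rewrite /dist; case: pselect => [ex|nex].
- case: ex_minnP => m ym _ rm yN; have [mN|Nm] := ltnP m N.
    by move: ym; rewrite yN.
  have := le2 N.+1 m.+1 Nm; lra.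
- by lra.
- move=> yN; case: ex_minnP => m _ mmin.
  apply: (le_trans r2); apply: le2; rewrite leqNgt; apply/negP => Nm.
  apply: yN => i iN; apply/eqP/negPn/negP => yi.
  by have := leq_ltn_trans (mmin _ yi) iN; rewrite ltnNge -ltnS Nm.
- move=> yN; exfalso; apply: yN => i _; apply/eqP/negPn/negP => yi.
  by apply: nex; exists i.
Qed.

Lemma PV_cvg (x : G) (v : R) :
  (fun N => psum mu f N.+1 x - pverr N x) @ \oo --> v -> PV_to mu f x v.
Proof.
move=> c; have {}c : (fun N => (psum mu f N.+1 x - pverr N x)%:E) @ \oo --> v%:E.
  by apply: cvg_EFin c; exact: nearW.
move=> A /c [n0 _ HA].
have e0 : 0 < 2^-1 ^+ n0 :> R by rewrite exprn_gt0.
suff : \forall r \near 0^'+, A (trunc_conv mu f x r) by [].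
near=> r.
have r0 : 0 < r by near: r; exact: nbhs_right_gt.
have rn : r < 2^-1 ^+ n0 by near: r; exact: nbhs_right_lt.
have exN : exists n, 2^-1 ^+ n.+1 < r.
  (* With n the integer part of 1 / r, one has 1 / r < n + 1 < 2^(n+1). The least such exponent then
     places [r] in its dyadic interval. *)
  exists (Num.truncn r^-1); rewrite exprVn invf_plt ?posrE ?exprn_gt0//.
  apply: (lt_trans (truncnS_gt _)); rewrite -natrX ltr_nat.
  exact: ltn_expl.
have [N rN Nmin] := ex_minnP exN.
have rN2 : r <= 2^-1 ^+ N.
  case: N rN Nmin => [|N] rN Nmin.
    by rewrite expr0 (le_trans (ltW rn))// exprn_ile1// invf_le1// ler1n.
  by rewrite leNgt; apply/negP => /Nmin; rewrite ltnn.
have nN : (n0 <= N)%N.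
  rewrite -ltnS ltnNge; apply/negP => Nn0.
  suff : 2^-1 ^+ n0 <= 2^-1 ^+ N.+1 :> R by lra.
  by apply: ler_wiXn2l => //; rewrite invf_le1// ler1n.
rewrite /trunc_conv /= (dist_ball N); last by rewrite rN.
by rewrite integral_kpair; exact: HA.
Unshelve. all: by end_near. Qed.

End principal_value.

(** * Square functions, truncation and tails of l^2-valued functions *)

Section l2_valued_functions.
Context {R : realType} (mu : {measure set G -> \bar R}).
Hypothesis haar_mu : haar mu.
Implicit Types (f : nat -> G -> R) (p : R).

Lemma l2sq_ge0 f x : (0 <= l2sq f x)%E.
Proof. by apply: nneseries_ge0 => n _ _; rewrite lee_fin sqr_ge0. Qed.

Lemma measurable_l2sq f : (forall n, measurable_fun [set: G] (f n)) ->
  measurable_fun [set: G] (l2sq f).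
Proof.
move=> mf; apply: (@ge0_emeasurable_sum _ _ _ _
  (fun n x => ((f n x) ^+ 2)%:E) xpredT) => //.
  by move=> k x _ _; rewrite lee_fin sqr_ge0.
by move=> k _; apply/measurable_EFinP; exact: measurable_funX.
Qed.

Lemma measurable_l2sq_poweR f p : (forall n, measurable_fun [set: G] (f n)) ->
  measurable_fun [set: G] (fun x => l2sq f x `^ p)%E.
Proof.
move=> mf; apply: (@measurableT_comp _ _ _ _ _ _ (fun y : \bar R => y `^ p)%E).
  exact: measurable_poweR.
exact: measurable_l2sq.
Qed.

Lemma vnorm_le_l2sq N f x p : 0 <= p ->
  ((vnorm N (f ^~ x) `^ p)%:E <= l2sq f x `^ (p / 2))%E.
Proof.
move=> p0; rewrite /vnorm -powR12_sqrt; last first.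
  by apply: sumr_ge0 => i _; exact: sqr_ge0.
rewrite -powRrM mulrC -poweR_EFin; apply: gt0_ler_poweR.
- by rewrite divr_ge0.
- rewrite in_itv/= leey andbT lee_fin; apply: sumr_ge0 => i _; exact: sqr_ge0.
- by rewrite in_itv/= leey andbT l2sq_ge0.
rewrite -sumEFin -(big_mkord xpredT (fun i => ((f i x) ^+ 2)%:E)).
by apply: nneseries_lim_ge => n _ _; rewrite lee_fin sqr_ge0.
Qed.

(** On a probability space |f| <= 1 + |f|^p suffices. It makes the almost everywhere results for
    exponent 1 available for every [p]. *)
Lemma Lp_l2_le1 p f : 1 <= p -> Lp_l2 mu p f -> Lp_l2 mu 1 f.
Proof.
move=> p1 [mf fp]; split=> //.
have p0 : 0 < p by rewrite (lt_le_trans _ p1).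
apply: (@le_lt_trans _ _ (\int[mu]_x (1 + l2sq f x `^ (p / 2)))%E).
  apply: ge0_le_integral => //.
  - by move=> x _; exact: poweR_ge0.
  - exact: (measurable_l2sq_poweR _ _ mf).
  - by apply: emeasurable_funD => //; exact: (measurable_l2sq_poweR _ _ mf).
  - move=> x _; have := l2sq_ge0 f x; case: (l2sq f x) => [r||]//; last first.
      by rewrite !poweRyr ?gt_eqF ?divr_gt0// addey.
    rewrite lee_fin => r0; rewrite !poweR_EFin -EFinD lee_fin.
    have [r1|r1] := leP r 1.
      rewrite (@le_trans _ _ 1) ?lerDl ?powR_ge0//.
      have h12 : 0 <= 1 / 2 :> R by rewrite divr_ge0.
      by have := ge0_ler_powR h12 r0 ler01 r1; rewrite powR1.
    have h12 : 1 / 2 <= p / 2 by rewrite ler_pM2r// invr_gt0.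
    by rewrite (le_trans (ler_powR (ltW r1) h12))// lerDr.
rewrite ge0_integralD//; last exact: (measurable_l2sq_poweR _ _ mf).
  by rewrite integral_cst// haarT// mule1 lte_add_pinfty// ltry.
by move=> x _; exact: poweR_ge0.
Qed.

Lemma Lp_l2_vnorm_integrable p f N : 0 <= p -> Lp_l2 mu p f ->
  mu.-integrable [set: G] (EFin \o (fun x => vnorm N (f ^~ x) `^ p)).
Proof.
move=> p0 [mf fp].
have mv : measurable_fun [set: G] (EFin \o (fun x => vnorm N (f ^~ x) `^ p)).
  apply/measurable_EFinP; apply: (measurableT_comp (measurable_powR p)).
  exact: measurable_vnorm.
apply/integrableP; split => //; apply: le_lt_trans fp.
apply: ge0_le_integral => //.
- exact: measurableT_comp.
- exact: (measurable_l2sq_poweR _ _ mf).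
- by move=> x _ /=; rewrite ger0_norm ?powR_ge0// vnorm_le_l2sq.
Qed.

Lemma Lp_l2_integrable f i : Lp_l2 mu 1 f -> mu.-integrable [set: G] (EFin \o f i).
Proof.
move=> f1; have := Lp_l2_vnorm_integrable 1 f i.+1 ler01 f1.
apply: intg_le; first by case: f1.
by move=> x; rewrite powRr1 ?vnorm_ge0//; exact: norm_le_vnorm.
Qed.

Lemma Rintegral_vnorm_le p f N : 0 <= p -> Lp_l2 mu p f ->
  ((\int[mu]_x (vnorm N (f ^~ x) `^ p))%:E <= \int[mu]_x (l2sq f x `^ (p / 2)))%E.
Proof.
move=> p0 fp; have iv := Lp_l2_vnorm_integrable p f N p0 fp.
rewrite /Rintegral fineK; last exact: integrable_fin_num.
apply: ge0_le_integral => //.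
- by move=> x _; rewrite lee_fin powR_ge0.
- exact: measurable_int iv.
- by apply: measurable_l2sq_poweR; case: fp.
- by move=> x _; exact: vnorm_le_l2sq.
Qed.

Definition tailf K f : nat -> G -> R := fun n => if (n < K)%N then fun=> 0 else f n.

Lemma l2sq_tailf K f x :
  l2sq (tailf K f) x = (\sum_(K <= n <oo) ((f n x) ^+ 2)%:E)%E.
Proof.
rewrite /l2sq (nneseries_split 0 K); last by move=> k _; rewrite lee_fin sqr_ge0.
rewrite add0n big_nat big1 ?add0e; last first.
  by move=> i /andP[_ iK]; rewrite /tailf iK expr0n.
rewrite eseries_cond [RHS]eseries_cond; apply: eq_eseriesr => n.
by move=> /= Kn; rewrite /tailf ltnNge Kn.
Qed.

Lemma l2sq_tailf_le K f x : (l2sq (tailf K f) x <= l2sq f x)%E.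
Proof.
apply: lee_nneseries => n; first by rewrite lee_fin sqr_ge0.
by move=> _; rewrite lee_fin /tailf; case: ifP => // _; rewrite expr0n sqr_ge0.
Qed.

Lemma measurable_tailf K f : (forall n, measurable_fun [set: G] (f n)) ->
  forall n, measurable_fun [set: G] (tailf K f n).
Proof. by move=> mf n; rewrite /tailf; case: ifP. Qed.

Lemma l2sq_tailf_poweR_le K f x p : 0 <= p ->
  (l2sq (tailf K f) x `^ p <= l2sq f x `^ p)%E.
Proof.
move=> p0; apply: gt0_ler_poweR => //; rewrite ?in_itv/= ?leey ?andbT ?l2sq_ge0//.
exact: l2sq_tailf_le.
Qed.

Lemma Lp_l2_tailf K f p : 0 <= p -> Lp_l2 mu p f -> Lp_l2 mu p (tailf K f).
Proof.
move=> p0 [mf fp]; split; first exact: measurable_tailf.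
apply: le_lt_trans fp; apply: ge0_le_integral => //.
- by move=> x _; exact: poweR_ge0.
- by apply: measurable_l2sq_poweR; exact: measurable_tailf.
- exact: (measurable_l2sq_poweR _ _ mf).
- by move=> x _; apply: l2sq_tailf_poweR_le; rewrite divr_ge0.
Qed.

(** Continuity of the power was derived from differentiability, hence only at positive points; a
    zero limit is handled by inverting the power. *)
Lemma powR_cvg (u : nat -> R) (l e : R) : 0 < e -> (forall n, 0 <= u n) ->
  u @ \oo --> l -> (fun n => u n `^ e) @ \oo --> l `^ e.
Proof.
move=> e0 u0 ul; have l0 : 0 <= l.
  by rewrite -(cvg_lim _ ul)//; apply: limr_ge; [apply/cvg_ex; exists l|exact: nearW].
move: l0; rewrite le_eqVlt => /predU1P[l0|l0]; last first.
  exact: (cvg_comp _ _ ul (powR_continuous_gt0 e l l0)).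
move: ul; rewrite -l0 powR0 ?gt_eqF// => /cvgr0Pnorm_lt ul.
apply/cvgr0Pnorm_lt => d d0.
have [n _ Hn] := ul (d `^ e^-1) (powR_gt0 _ d0).
exists n => // m /= nm; rewrite ger0_norm ?powR_ge0//.
have := Hn m nm; rewrite /= ger0_norm// => h.
by rewrite -[e]invrK powR_lt_iff ?invr_gt0// ltW.
Qed.

(** Dominated convergence: the square function is finite almost everywhere, so there its tails tend
    to 0, and they stay below the whole. *)
Lemma integral_tailf_cvg p f : 0 < p -> Lp_l2 mu p f ->
  (\int[mu]_x (l2sq (tailf K f) x `^ (p / 2)))%E @[K --> \oo] --> 0%E.
Proof.
move=> p0 fp; have [mf fpoo] := fp.
have p20 : 0 < p / 2 by rewrite divr_gt0.
have ig : mu.-integrable [set: G] (fun x => l2sq f x `^ (p / 2))%E.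
  apply/integrableP; split; first exact: (measurable_l2sq_poweR _ _ mf).
  by under eq_integral do rewrite gee0_abs ?poweR_ge0//.
have aefin : {ae mu, forall x, (l2sq f x < +oo)%E}.
  have := integrable_ae measurableT ig; apply: filterS => x /(_ I) h.
  apply: (@lty_poweRy _ _ (p / 2)); first by rewrite gt_eqF.
  by move: h; rewrite fin_numElt => /andP[].
have [] := @dominated_convergence _ _ _ mu _ measurableT
  (fun K x => l2sq (tailf K f) x `^ (p / 2))%E (cst 0%E) _ _ _ _ ig.
- by move=> K; apply: measurable_l2sq_poweR; exact: measurable_tailf.
- by [].
- move: aefin; apply: filterS => x xoo _.
  have uc : l2sq (tailf K f) x @[K --> \oo] --> 0%E.
    under eq_fun do rewrite l2sq_tailf.
    by apply: nneseries_tail_cvg => // k _; rewrite lee_fin sqr_ge0.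
  have ufin K : l2sq (tailf K f) x \is a fin_num.
    by rewrite ge0_fin_numE ?l2sq_ge0// (le_lt_trans (l2sq_tailf_le _ _ _)).
  have /fine_cvgP[_ vc] := uc.
  have := powR_cvg _ _ _ p20 (fun K => fine_ge0 (l2sq_ge0 (tailf K f) x)) vc.
  rewrite powR0 ?gt_eqF// => {}vc.
  under eq_fun do rewrite -[l2sq _ _]fineK// poweR_EFin.
  by apply: cvg_EFin vc; exact: nearW.
- apply: aeW => x K _; rewrite gee0_abs ?poweR_ge0//.
  by apply: l2sq_tailf_poweR_le; exact: ltW.
by move=> _ _; rewrite integral0.
Qed.

End l2_valued_functions.

(** * Almost everywhere convergence of the partial sums and of the error *)

Section almost_everywhere_convergence.
Context {R : realType} (mu : {measure set G -> \bar R}).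
Hypothesis haar_mu : haar mu.

Lemma aeI (P Q : G -> Prop) : {ae mu, forall x, P x} -> {ae mu, forall x, Q x} ->
  {ae mu, forall x, P x /\ Q x}.
Proof. exact: (@filterI _ _ (ae_filter_ringOfSetsType mu) P Q). Qed.

(** The exceptional sets for d = 1 / (k + 1) intersect in a null set. [Q] itself need not define a
    measurable set, which suits Cauchy-type conditions. *)
Lemma ae_small_exceptions (Q : G -> Prop) :
  (forall d : R, 0 < d -> exists B : set G,
    [/\ measurable B, (mu B <= d%:E)%E & forall x, ~ B x -> Q x]) ->
  {ae mu, forall x, Q x}.
Proof.
move=> H; have d0 k : 0 < k.+1%:R^-1 :> R by rewrite invr_gt0 ltr0n.
have /choice[B HB] : forall k, exists B : set G,
    [/\ measurable B, (mu B <= (k.+1%:R^-1)%:E)%E & forall x, ~ B x -> Q x].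
  by move=> k; exact: H.
exists (\bigcap_k B k); split.
- by apply: bigcapT_measurable => k; have [] := HB k.
- apply/eqP; rewrite eq_le measure_ge0 andbT; apply/lee_addgt0Pr => e e0.
  have [k _ hk] := near_infty_natSinv_lt (PosNum e0).
  have [mB muB _] := HB k.
  rewrite add0e; apply: (@le_trans _ _ (mu (B k))).
    apply: le_measure; rewrite ?inE.
    - by apply: bigcapT_measurable => j; have [] := HB j.
    - exact: mB.
    - by move=> y; apply.
  by apply: (le_trans muB); rewrite lee_fin ltW//; exact: (hk k (leqnn k)).
- move=> x /= nQ k _; apply: contrapT => nB.
  by have [_ _ /(_ x nB)] := HB k.
Qed.

Lemma markov_small (t d : R) (A : set G) (K : \bar R) : 0 < t ->
  (t%:E * mu A <= K)%E -> (K <= (t * d)%:E)%E -> (mu A <= d%:E)%E.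
Proof.
move=> t0 h1 h2; rewrite -(@lee_pmul2l _ t%:E)//.
by rewrite -EFinM; apply: le_trans h2.
Qed.

Section one_function.
Variable f : nat -> G -> R.
Hypothesis f1 : Lp_l2 mu 1 f.

Let fi i : mu.-integrable [set: G] (EFin \o f i).
Proof. exact: Lp_l2_integrable. Qed.

Let vnorm1 N : ((\int[mu]_x vnorm N (f ^~ x))%:E <= \int[mu]_x (l2sq f x `^ (1 / 2)))%E.
Proof.
have := Rintegral_vnorm_le mu 1 f N ler01 f1; apply: le_trans.
rewrite lee_fin le_eqVlt; apply/orP; left; apply/eqP.
by apply: eq_Rintegral => x _; rewrite powRr1 ?vnorm_ge0.
Qed.

Lemma weak_type_psum (t : R) : 0 < t ->
  (t%:E * mu [set x | exists n, (t < `|psum mu f n.+1 x|)%R] <=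
   2%:E * \int[mu]_x (l2sq f x `^ (1 / 2)))%E.
Proof.
move=> t0; apply: maximal_limit => //.
  by move=> n; exact: measurable_psum.
move=> N; apply: (le_trans (weak_type_finite _ haar_mu f fi N t t0)).
by rewrite EFinM lee_pmul2l.
Qed.

Lemma sum_kcoef N : \sum_(n < N.+1) kcoef n ^+ 2 <= (2 ^+ N) ^+ 2 :> R.
Proof.
elim: N => [|N IH]; first by rewrite big_ord_recl big_ord0 /= addr0 expr0.
rewrite big_ord_recr /= (le_trans (lerD IH (lexx _)))// [2 ^+ N.+1]exprS exprMn.
by have := sqr_ge0 (2 ^+ N : R); lra.
Qed.

(** Cauchy-Schwarz pairs [f] with [kcoef], whose norm at most 2^n cancels the factor 2^-n. Using the
    norm of length [N.+1] for all n <= N gives one majorant, as the maximal inequality requires. *)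
Lemma pverr_le n N x : (n <= N)%N ->
  `|pverr mu f n x| <= condE mu n (fun y => vnorm N.+1 (f ^~ y)) x.
Proof.
move=> nN; rewrite /pverr -condE_lincomb//.
have il := intg_lincomb mu haar_mu n.+1 kcoef f fi.
rewrite -condEZ//.
have iz : mu.-integrable [set: G]
    (EFin \o (fun y => 2^-1 ^+ n * \sum_(i < n.+1) kcoef i * f i y)).
  exact: intgZ.
apply: (le_trans (norm_condE _ _ _ _ iz)); apply: ler_condE.
- exact: intg_norm.
- exact: intg_vnorm.
move=> y; rewrite normrM ger0_norm ?exprn_ge0//.
have vN : vnorm n.+1 (f ^~ y) <= vnorm N.+1 (f ^~ y).
  rewrite ler_sqrt; last by apply: sumr_ge0 => i _; exact: sqr_ge0.
  rewrite -!(big_mkord xpredT (fun i => f i y ^+ 2)).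
  rewrite [leRHS](@big_cat_nat _ _ _ n.+1)//= lerDl.
  by apply: sumr_ge0 => i _; exact: sqr_ge0.
have kN : vnorm n.+1 kcoef <= 2 ^+ n :> R.
  rewrite -(@ler_pXn2r _ 2) ?nnegrE ?vnorm_ge0 ?exprn_ge0// vnormE.
  exact: sum_kcoef.
apply: (@le_trans _ _ (2^-1 ^+ n * (2 ^+ n * vnorm N.+1 (f ^~ y)))).
  rewrite ler_wpM2l ?exprn_ge0//; apply: (le_trans (vdot_vnorm n.+1 kcoef (f ^~ y))).
  by rewrite ler_pM ?vnorm_ge0.
by rewrite mulrA -exprMn mulVf// expr1n mul1r.
Qed.

Lemma depends_on_pverr n : depends_on n (pverr mu f n).
Proof.
move=> x y xy; rewrite /pverr; congr (_ * _); apply: eq_bigr => i _.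
by rewrite (depends_on_condE mu n (f i) x y).
Qed.

Lemma condE_maximal (F : G -> R) N (t : R) (Z : nat -> G -> R) :
  (forall x, 0 <= F x) -> mu.-integrable [set: G] (EFin \o F) ->
  (forall n, depends_on n (Z n)) -> 0 < t ->
  (forall n x, (n <= N)%N -> `|Z n x| <= condE mu n F x) ->
  (t%:E * mu [set x | exists2 n, (n <= N)%N & (t < `|Z n x|)%R] <=
   (\int[mu]_x F x)%:E)%E.
Proof.
move=> F0 iF dZ t0 ZF.
have dU n : depends_on n (condE mu n F) by exact: depends_on_condE.
have sU : supermartingale N (fun n => condE mu n F).
  by move=> n x _; rewrite condE_half.
have := doob_maximal mu haar_mu N t _ (fun n x => condE_ge0 mu n F x F0) dU sU.
rewrite condE0; apply: le_trans; rewrite lee_pmul2l//.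
apply: le_measure; rewrite ?inE.
- apply: measurable_exists_gt => n.
  exact: depends_on_measurable (dZ n).
- exact: (measurable_exists_ge N t (fun n => condE mu n F)).
- by move=> x [n nN h]; exists n => //; rewrite ltW// (lt_le_trans h)// ZF.
Qed.

Lemma weak_type_pverr (t : R) : 0 < t ->
  (t%:E * mu [set x | exists n, (t < `|pverr mu f n x|)%R] <=
   \int[mu]_x (l2sq f x `^ (1 / 2)))%E.
Proof.
move=> t0; apply: maximal_limit => //.
  by move=> n; exact: depends_on_measurable (depends_on_pverr n).
move=> N; apply: le_trans (vnorm1 N.+1).
apply: condE_maximal => //.
- by move=> x; exact: vnorm_ge0.
- exact: intg_vnorm.
- exact: depends_on_pverr.
- by move=> n x; exact: pverr_le.
Qed.

(** Boundedness is what the error term asks of each single coordinate: its contribution carries a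
    factor 2^-n. *)
Lemma ae_bounded_condE :
  {ae mu, forall x, forall i, exists B, forall n, `|condE mu n (f i) x| <= B}.
Proof.
apply: ae_foralln => i; apply: ae_small_exceptions => d d0.
pose K := \int[mu]_x `|f i x|.
have K0 : 0 <= K by exact: Rintegral_ge0.
pose t := (K + 1) / d.
have t0 : 0 < t by rewrite divr_gt0// ltr_wpDl.
exists [set x | exists n, t < `|condE mu n (f i) x|]; split.
- rewrite (_ : [set _ | _] = [set x | exists2 n, True & t < `|condE mu n (f i) x|]).
    apply: measurable_exists_gt => n.
    exact: depends_on_measurable (depends_on_condE mu n (f i)).
  by apply/seteqP; split => x [n]; exists n.
- apply: (markov_small t d _ K%:E) => //; last first.
    by rewrite lee_fin /t divfK ?gt_eqF// lerDl.
  apply: maximal_limit => // [n|N].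
    exact: depends_on_measurable (depends_on_condE mu n (f i)).
  apply: condE_maximal => //.
  + exact: intg_norm.
  + by move=> n; exact: depends_on_condE.
  + by move=> n x _; exact: norm_condE.
- move=> x nB; exists t => n; rewrite leNgt; apply/negP => h.
  by apply: nB; exists n.
Qed.

End one_function.

Variable f : nat -> G -> R.
Hypothesis f1 : Lp_l2 mu 1 f.

Let ft K : Lp_l2 mu 1 (tailf K f).
Proof. exact: Lp_l2_tailf. Qed.

Lemma small_tail (d : R) : 0 < d ->
  exists K, (\int[mu]_x (l2sq (tailf K f) x `^ (1 / 2)) <= d%:E)%E.
Proof.
move=> d0; have /fine_cvgP[[n1 _ Hn1]] := integral_tailf_cvg mu 1 f ltr01 f1.
move=> /cvgr0Pnorm_lt /(_ d d0)[n2 _ Hn2].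
exists (maxn n1 n2).
have h1 := Hn1 (maxn n1 n2) (leq_maxl _ _).
have h2 := Hn2 (maxn n1 n2) (leq_maxr _ _).
by rewrite -[leLHS]fineK// lee_fin (le_trans (ler_norm _))// ltW.
Qed.

Lemma psum_tailf K k x :
  psum mu (tailf K f) (K + k) x = psum mu f (K + k) x - psum mu f K x.
Proof.
have D0 n : Delta mu n (fun=> 0) x = 0.
  by case: n => [|n] /=; rewrite !condE_cst// subrr.
have psumK : psum mu (tailf K f) K x = 0.
  by rewrite /psum big1// => -[i iK] _ /=; rewrite /tailf iK D0.
elim: k => [|k IH]; first by rewrite addn0 subrr.
rewrite addnS /psum !big_ord_recr /= -!/(psum _ _ _ _) IH /tailf.
by rewrite ltnNge leq_addr /= addrAC.
Qed.

Lemma ae_cauchy_psum : {ae mu, forall x, forall e : nat, exists n0,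
  forall m n, (n0 <= m)%N -> (n0 <= n)%N ->
    `|psum mu f m x - psum mu f n x| <= e.+1%:R^-1}.
Proof.
apply: ae_foralln => e; apply: ae_small_exceptions => d d0.
pose t : R := e.+1%:R^-1 / 2.
have t0 : 0 < t by rewrite divr_gt0// invr_gt0 ltr0n.
(* The 2 offsets the weak-type constant, leaving an exceptional set of measure at most [d]. *)
have [K HK] := small_tail (t * d / 2) (divr_gt0 (mulr_gt0 t0 d0) (ltr0Sn _ 1)).
exists [set x | exists n, t < `|psum mu (tailf K f) n.+1 x|]; split.
- rewrite (_ : [set _ | _] =
    [set x | exists2 n, True & t < `|psum mu (tailf K f) n.+1 x|]).
    by apply: measurable_exists_gt => n; exact: measurable_psum.
  by apply/seteqP; split => x [n]; exists n.
- apply: (markov_small t d _ _ t0 (weak_type_psum _ (ft K) t t0)).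
  rewrite (_ : t * d = 2 * (t * d / 2)); last by rewrite [RHS]mulrC divfK.
  by rewrite EFinM lee_pmul2l.
- move=> x nB; exists K.+1 => m n Km Kn.
  have H j : (K.+1 <= j)%N -> `|psum mu f j x - psum mu f K x| <= t.
    move=> Kj; rewrite -(subnKC (ltnW Kj)) -psum_tailf subnKC ?(ltnW Kj)//.
    rewrite leNgt; apply/negP => h; apply: nB; exists j.-1.
    by rewrite prednK// (leq_ltn_trans _ Kj).
  have := H m Km; have := H n Kn; rewrite distrC => hn hm.
  rewrite (_ : psum mu f m x - _ = (psum mu f m x - psum mu f K x) +
    (psum mu f K x - psum mu f n x)); last by rewrite addrA subrK.
  rewrite (le_trans (ler_normD _ _))// (le_trans (lerD hm hn))//.
  by rewrite /t -splitr.
Qed.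

(** The tail of [f] is controlled by the maximal inequality; the first K coordinates contribute at
    most 2^-n times a number depending on x. The boundedness of the conditional means is kept as a
    premise at the point [x], so that the exceptional set concerns the tail alone. *)
Lemma ae_pverr_small : {ae mu, forall x, forall e : nat,
  (forall i, exists B, forall n, `|condE mu n (f i) x| <= B) ->
  exists n0, forall n, (n0 <= n)%N -> `|pverr mu f n x| <= e.+1%:R^-1}.
Proof.
apply: ae_foralln => e; apply: ae_small_exceptions => d d0.
pose t : R := e.+1%:R^-1 / 2.
have t0 : 0 < t by rewrite divr_gt0// invr_gt0 ltr0n.
have [K HK] := small_tail (t * d) (mulr_gt0 t0 d0).
exists [set x | exists n, t < `|pverr mu (tailf K f) n x|]; split.
- rewrite (_ : [set _ | _] =
    [set x | exists2 n, True & t < `|pverr mu (tailf K f) n x|]).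
    apply: measurable_exists_gt => n.
    exact: depends_on_measurable (depends_on_pverr (tailf K f) n).
  by apply/seteqP; split => x [n]; exists n.
- exact: (markov_small t d _ _ t0 (weak_type_pverr _ (ft K) t t0)).
- move=> x nB /choice[B HB].
  have nB' n : `|pverr mu (tailf K f) n x| <= t.
    by rewrite leNgt; apply/negP => h; apply: nB; exists n.
  pose D := \sum_(i < K) kcoef i * B i.
  have k0 i : 0 <= kcoef i :> R by case: i => //= i; exact: exprn_ge0.
  have diff n : (K <= n.+1)%N -> `|pverr mu f n x - pverr mu (tailf K f) n x| <=
      2^-1 ^+ n * D.
    move=> Kn; rewrite /pverr -mulrBr -sumrB normrM ger0_norm ?exprn_ge0//.
    rewrite ler_wpM2l ?exprn_ge0// /D (big_ord_widen_cond n.+1 xpredT (fun i => kcoef i * B i))//=.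
    rewrite [leRHS]big_mkcond /=.
    apply: (le_trans (ler_norm_sum _ _ _)); apply: ler_sum => i _.
    rewrite /tailf; case: ifP => iK; last by rewrite subrr normr0.
    by rewrite condE_cst// mulr0 subr0 normrM ger0_norm// ler_wpM2l.
  have h2 : `|2^-1 : R| < 1 by rewrite ger0_norm// invf_lt1// ltr1n.
  have : (fun n => 2^-1 ^+ n * D) @ \oo --> 0.
    by rewrite -(mul0r D); apply: cvgMl; exact: cvg_expr.
  move=> /cvgr0Pnorm_lt /(_ t t0)[n1 _ Hn1].
  exists (maxn n1 K) => n; rewrite geq_max => /andP[n1n Kn].
  have h3 := Hn1 n n1n.
  have h4 := diff n (leqW Kn).
  rewrite -(subrK (pverr mu (tailf K f) n x) (pverr mu f n x)).
  rewrite (le_trans (ler_normD _ _))// [leRHS]splitr -/t lerD//.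
  by rewrite (le_trans h4)// (le_trans (ler_norm _))// ltW.
Qed.

(** An upper limit is measurable and defined everywhere; it is the limit wherever the sums converge,
    and [fine] turns infinite values into 0 elsewhere. *)
Definition pvlim (x : G) : R := fine (limn_esup (fun n => (psum mu f n x)%:E)).

Lemma measurable_pvlim : measurable_fun [set: G] pvlim.
Proof.
apply: measurableT_comp => //; apply: measurable_fun_limn_esup => n.
by apply/measurable_EFinP; exact: measurable_psum.
Qed.

Lemma ae_psum_cvg : {ae mu, forall x, psum mu f n x @[n --> \oo] --> pvlim x}.
Proof.
have := ae_cauchy_psum; apply: filterS => x H.
have c : cvg (psum mu f n x @[n --> \oo]).
  apply/cauchy_cvgP; apply: cauchy_exP => e e0.
  have [k _ hk] := near_infty_natSinv_lt (PosNum e0).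
  have [n0 Hn0] := H k.
  exists (psum mu f n0 x); exists n0 => // n /= n0n.
  by apply: (le_lt_trans (Hn0 n0 n (leqnn _) n0n)); exact: (hk k (leqnn k)).
have [l cl] := (cvg_ex _).1 c.
have clE : (psum mu f n x)%:E @[n --> \oo] --> l%:E.
  by apply: cvg_EFin cl; exact: nearW.
by rewrite /pvlim (cvg_limn_einf_sup clE).
Qed.

Lemma ae_PV : {ae mu, forall x, PV_to mu f x (pvlim x)}.
Proof.
have fi i : mu.-integrable [set: G] (EFin \o f i) by exact: Lp_l2_integrable.
have := aeI _ _ (aeI _ _ ae_psum_cvg ae_pverr_small) (ae_bounded_condE f f1).
apply: filterS => x [[cx He] Hb].
apply: PV_cvg => //; rewrite -[pvlim x]subr0; apply: cvgB.
  by move: cx; rewrite -(cvg_shiftS (fun n => psum mu f n x)).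
apply/cvgr0Pnorm_lt => d d0.
have [k _ hk] := near_infty_natSinv_lt (PosNum d0).
have [n0 Hn0] := He k Hb; exists n0 => // n /= n0n.
by apply: (le_lt_trans (Hn0 n n0n)); exact: (hk k (leqnn k)).
Qed.

End almost_everywhere_convergence.

(** * Passage of the bounds to the limit *)

Section limits_of_integrals.
Context {R : realType} (mu : {measure set G -> \bar R}).
Hypothesis haar_mu : haar mu.

Lemma fatou_bound (h : nat -> G -> R) (k : G -> R) (c : \bar R) :
  (forall n, measurable_fun [set: G] (h n)) -> measurable_fun [set: G] k ->
  (forall n x, 0 <= h n x) -> (forall x, 0 <= k x) ->
  {ae mu, forall x, h n x @[n --> \oo] --> k x} ->
  (forall n, (\int[mu]_x (h n x)%:E <= c)%E) ->
  (\int[mu]_x (k x)%:E <= c)%E.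
Proof.
move=> mh mk h0 k0 hk hc.
have mhE n : measurable_fun [set: G] (EFin \o h n) by exact/measurable_EFinP.
have -> : (\int[mu]_x (k x)%:E = \int[mu]_x limn_einf (fun n => (h n x)%:E))%E.
  apply: ae_eq_integral => //.
  - exact/measurable_EFinP.
  - apply: (emeasurable_fun_cvg (fun n x => einfs (fun m => (h m x)%:E) n)) => [m|x _].
      exact: (measurable_fun_einfs mhE).
    by rewrite limn_einf_lim; exact: is_cvg_einfs.
  - move: hk; apply: filterS => x hx _.
    have hxE : (h n x)%:E @[n --> \oo] --> (k x)%:E.
      by apply: cvg_EFin hx; exact: nearW.
    by rewrite (cvg_limn_einf_sup hxE).
apply: le_trans (fatou _ _ _ _) _ => //.
  by move=> n x _; rewrite lee_fin.
rewrite limn_einf_lim; apply: lime_le; first exact: is_cvg_einfs.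
apply: nearW => n; apply: le_trans (hc n).
by apply: ereal_inf_lbound; exists n => /=.
Qed.

Lemma psum_integral_le p : 1 < p -> exists2 C : R, 0 <= C &
  forall N f, Lp_l2 mu p f ->
    (\int[mu]_x (`|psum mu f N.+1 x| `^ p)%:E <=
     C%:E * \int[mu]_x (l2sq f x `^ (p / 2)))%E.
Proof.
move=> p1; have [C C0 HC] := psum_lp mu haar_mu p p1; exists C => // N f fp.
have p0 : 0 <= p by rewrite (le_trans _ (ltW p1)).
have f1 := Lp_l2_le1 mu haar_mu p f (ltW p1) fp.
have := HC N f (fun i => Lp_l2_integrable mu f i f1)
  (Lp_l2_vnorm_integrable mu p f N.+1 p0 fp).
rewrite -lee_fin EFinM => H.
rewrite -[leLHS]fineK; last first.
  apply: integrable_fin_num => //; apply: (depends_on_integrable mu haar_mu N).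
  by move=> x y xy; rewrite (depends_on_psum mu f N x y).
apply: (le_trans H); apply: lee_pmul => //.
- by rewrite lee_fin Rintegral_ge0// => x _; exact: powR_ge0.
- exact: Rintegral_vnorm_le.
Qed.

(** The inequality defining the set is strict, so a limit beyond [lam] forces some partial sum
    beyond [lam]: up to a null set, the maximal event contains this one. *)
Lemma weak_type_pvlim f (lam : R) : Lp_l2 mu 1 f -> 0 < lam ->
  (lam%:E * mu [set x : G | (lam < `|pvlim mu f x|)%R] <=
   2%:E * \int[mu]_x (l2sq f x `^ (1 / 2)))%E.
Proof.
move=> f1 lam0; apply: le_trans (weak_type_psum mu haar_mu f f1 lam lam0).
rewrite lee_pmul2l//.
set E := [set x | exists n, lam < `|psum mu f n.+1 x|].
have mE : measurable E.
  rewrite (_ : E = [set x | exists2 n, True & lam < `|psum mu f n.+1 x|]).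
    by apply: measurable_exists_gt => n; exact: measurable_psum.
  by apply/seteqP; split => x [n]; exists n.
have mA : measurable [set x : G | lam < `|pvlim mu f x|].
  rewrite (_ : [set _ | _] = [set x | exists2 n, n = 0%N & lam < `|pvlim mu f x|]).
    by apply: (measurable_exists_gt _ _ (fun=> pvlim mu f)) => n; exact: measurable_pvlim.
  by apply/seteqP; split => x; [exists 0%N|case].
have [N [mN N0 subN]] := ae_psum_cvg mu haar_mu f f1.
apply: (@le_trans _ _ (mu (E `|` N))).
  apply: le_measure; rewrite ?inE//; first exact: measurableU.
  move=> x lx; have [Nx|Nx] := pselect (N x); [by right|left].
  have cx : psum mu f n x @[n --> \oo] --> pvlim mu f x.
    by apply: contrapT => ncx; apply: Nx; exact: subN.
  have /cvgr_norm_gt := cx => /(_ lam lx)[n _ Hn].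
  by exists n; apply: Hn => /=.
apply: (@le_trans _ _ (mu E + mu N)%E); first exact: measureU2.
by rewrite N0 adde0.
Qed.

Lemma strong_type_pvlim p : 1 < p -> exists C : R, forall f, Lp_l2 mu p f ->
  (\int[mu]_x (`|pvlim mu f x| `^ p)%:E <=
   C%:E * \int[mu]_x (l2sq f x `^ (p / 2)))%E.
Proof.
move=> p1; have [C C0 HC] := psum_integral_le p p1; exists C => f fp.
have f1 := Lp_l2_le1 mu haar_mu p f (ltW p1) fp.
have mpow (h : G -> R) : measurable_fun [set: G] h ->
    measurable_fun [set: G] (fun x => `|h x| `^ p).
  move=> mh; apply: (measurableT_comp (measurable_powR p)).
  exact: measurableT_comp.
apply: (fatou_bound (fun n x => `|psum mu f n.+1 x| `^ p)).
- by move=> n; apply: mpow; exact: measurable_psum.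
- by apply: mpow; exact: measurable_pvlim.
- by move=> n x; exact: powR_ge0.
- by move=> x; exact: powR_ge0.
- have := ae_psum_cvg mu haar_mu f f1; apply: filterS => x cx.
  apply: powR_cvg => //; first by rewrite (lt_trans _ p1).
  apply: cvg_norm; move: cx.
  by rewrite -(cvg_shiftS (fun n => psum mu f n x)).
- by move=> n; exact: HC.
Qed.

Lemma L2_limit_pvlim f : Lp_l2 mu 2 f ->
  (\int[mu]_x ((pvlim mu f x - psum mu f N x) ^+ 2)%:E)%E @[N --> \oo] --> 0%E.
Proof.
move=> f2; have [|C C0 HC] := psum_integral_le 2; first by rewrite ltr1n.
have f1 : Lp_l2 mu 1 f by apply: Lp_l2_le1 f2 => //; rewrite ler1n.
apply: (@squeeze_cvge _ _ _ _ (cst 0%E) _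
  (fun N => C%:E * \int[mu]_x (l2sq (tailf N f) x `^ (2 / 2)))%E).
- apply: nearW => N; apply/andP; split.
    by apply: integral_ge0 => x _; rewrite lee_fin sqr_ge0.
  have msq (u v : G -> R) : measurable_fun [set: G] u -> measurable_fun [set: G] v ->
      measurable_fun [set: G] (fun x => (u x - v x) ^+ 2).
    by move=> mu' mv; apply: measurable_funX; exact: measurable_funB.
  (* These differences are the partial sums of the tail of [f] from [N] on, so the exponent 2 bound
     applied to the tail controls them uniformly in [n]. *)
  apply: (fatou_bound (fun n x => (psum mu f (N + n.+1) x - psum mu f N x) ^+ 2)).
  + by move=> n; apply: msq; exact: measurable_psum.
  + by apply: msq; [exact: measurable_pvlim|exact: measurable_psum].
  + by move=> n x; exact: sqr_ge0.
  + by move=> x; exact: sqr_ge0.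
  + have := ae_psum_cvg mu haar_mu f f1; apply: filterS => x cx.
    have c1 : psum mu f (N + n.+1) x @[n --> \oo] --> pvlim mu f x.
      move: cx; rewrite -(cvg_shiftn N.+1 (fun n => psum mu f n x)).
      by under eq_fun do rewrite addnC addSnnS.
    have d : psum mu f (N + n.+1) x - psum mu f N x @[n --> \oo] -->
        pvlim mu f x - psum mu f N x by apply: cvgB => //; exact: cvg_cst.
    exact: (cvgM d d).
  + move=> n; have ft : Lp_l2 mu 2 (tailf N f) by exact: Lp_l2_tailf.
    apply: le_trans (HC (N + n)%N _ ft); rewrite le_eqVlt; apply/orP; left; apply/eqP.
    apply: eq_integral => x _; rewrite powR_mulrn// real_normK ?num_real//.
    by rewrite -addnS psum_tailf.
- exact: cvg_cst.
- rewrite -(mule0 C%:E); apply: cvgeZl => //.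
  exact: integral_tailf_cvg.
Qed.

End limits_of_integrals.

Theorem theorem4p12 (R : realType) (mu : {measure set G -> \bar R}) :
  haar mu ->
  (* L^2 case: P.V.(k*f) = iota^{-1} P f = sum_n Delta_n f_n (L^2-convergent) *)
  (forall f : nat -> G -> R, Lp_l2 mu 2 f ->
     exists g : G -> R, measurable_fun [set: G] g /\
       {ae mu, forall x, PV_to mu f x (g x)} /\
       (fun N => \int[mu]_x (((g x - \sum_(n < N) Delta mu n (f n) x) ^+ 2)%:E))%E
         @ \oo --> 0%E) /\
  (* weak (1,1): L^1(G, l^2) -> L^{1,oo}(G) *)
  (exists C : R, forall f : nat -> G -> R, Lp_l2 mu 1 f ->
     exists g : G -> R, measurable_fun [set: G] g /\
       {ae mu, forall x, PV_to mu f x (g x)} /\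
       forall lam : R, 0 < lam ->
         (lam%:E * mu [set x : G | (lam < `|g x|)%R]
            <= C%:E * \int[mu]_x (l2sq f x `^ (2^-1)))%E) /\
  (* strong (p,p): L^p(G, l^2) -> L^p(G), 1 < p < oo *)
  (forall p : R, 1 < p -> exists C : R, forall f : nat -> G -> R, Lp_l2 mu p f ->
     exists g : G -> R, measurable_fun [set: G] g /\
       {ae mu, forall x, PV_to mu f x (g x)} /\
       (\int[mu]_x ((`|g x| `^ p)%:E) <= C%:E * \int[mu]_x (l2sq f x `^ (p / 2)))%E).
Proof.
(* [pvlim mu f] is the witness in all three cases, so the operators on the different spaces are
   restrictions of one another. *)
move=> haar_mu; split=> [f f2|].
  exists (pvlim mu f); split; first exact: measurable_pvlim.
  split; last exact: L2_limit_pvlim.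
  by apply: ae_PV => //; apply: Lp_l2_le1 f2 => //; rewrite ler1n.
split=> [|p p1].
  exists 2 => f f1; exists (pvlim mu f); split; first exact: measurable_pvlim.
  split=> [|lam lam0]; first exact: ae_PV.
  by rewrite -[2^-1]div1r; exact: weak_type_pvlim.
have [C HC] := strong_type_pvlim mu haar_mu p p1; exists C => f fp.
exists (pvlim mu f); split; first exact: measurable_pvlim.
split; last exact: HC.
by apply: ae_PV => //; apply: Lp_l2_le1 fp => //; exact: ltW.
Qed.
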